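(* Consider one round $t$ of the following federated learning protocol with $N$ clients and a trusted parameter server (PS), model dimension $m$, clipping threshold $C>0$, noise parameter $\sigma>0$ and sampling probability $p\in(0,1]$. Each client $i\in[N]$ holds a local dataset $\mathcal{D}_i$ and forms a batch $\mathcal{B}_{i,t}\subseteq\mathcal{D}_i$ by Poisson sampling (each sample is included independently with probability $p$); the average batch size is $B=p|\mathcal{D}_i|$. For each $d\in\mathcal{B}_{i,t}$ the client computes the per-sample gradient $\nabla\ell(\mathbf{w}_t,d)\in\mathbb{R}^m$ and clips it to $\nabla\ell(\mathbf{w}_t,d)/\max\{1,\|\nabla\ell(\mathbf{w}_t,d)\|_2/C\}$, and then forms $\bar{\mathbf{g}}_{i,t}=\frac{1}{B}\sum_{d\in\mathcal{B}_{i,t}}\nabla\ell(\mathbf{w}_t,d)$ (with clipped gradients). For each coordinate $j\in[m]$, client $i$ samples $v_{i,j}\sim\Gamma[3/2,1/2]$ (gamma distribution with shape $3/2$ and rate $1/2$), sets $\Delta_{i,j}=2\sigma\sqrt{v_{i,j}}$, samples $U_{i,j}\sim\mathrm{Unif}(-\Delta_{i,j}/2,\Delta_{i,j}/2)$, and sends to the PS the quantized value $Q_{\Delta_{i,j}}\big((\bar{\mathbf{g}}_{i,t})_j+U_{i,j}\big)$, where $Q_\Delta(x)=\mathrm{round}\!\left(\frac{x-\Delta/2}{\Delta}\right)\Delta+\frac{\Delta}{2}$ and $\mathrm{round}$ rounds to the nearest integer. All $v_{i,j}$ and $U_{i,j}$ are sampled independently (over $i$ and $j$) and are shared with the PS via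 common randomness between client $i$ and the PS, but are unknown to every other client. The PS forms the estimate $(\hat{\mathbf{g}}_{i,t})_j=Q_{\Delta_{i,j}}\big((\bar{\mathbf{g}}_{i,t})_j+U_{i,j}\big)-U_{i,j}$ and the global average $\mathbf{g}=\frac{1}{N}\sum_{i\in[N]}\hat{\mathbf{g}}_{i,t}$. Then, from the perspective of any party not having access to the shared randomness $(v_{i,j},U_{i,j})$, $\mathbf{g}$ is a noisy estimate of the average of the local gradients of the form $$\mathbf{g}=\frac{1}{N}\sum_{i\in[N]}\bar{\mathbf{g}}_{i,t}+\mathcal{N}\!\left(0,\frac{\sigma^2}{N}\mathbf{I}_m\right).$$ Hence, for every $\varepsilon'>0$, $\mathbf{g}$ satisfies sample-level $(\varepsilon,\delta)$-differential privacy against the clients with $\varepsilon=\log\big(1+p(e^{\varepsilon'}-1)\big)$ and $$\delta=p\cdot\Phi\!\left(\frac{C}{\sigma B\sqrt{N}}-\frac{\varepsilon'\sigma B\sqrt{N}}{2C}\right)-p\cdot e^{\varepsilon'}\Phi\!\left(-\frac{C}{\sigma B\sqrt{N}}-\frac{\varepsilon'\sigma B\sqrt{N}}{2C}\right),$$ where $\Phi$ is the CDF of the standard normal distribution.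
   Context: A randomized algorithm $\mathcal{M}$ satisfies $(\varepsilon,\delta)$-DP ($\varepsilon>0$, $\delta\in[0,1)$) if $\Pr[\mathcal{M}(\mathcal{D})\in\mathcal{O}]\le e^{\varepsilon}\Pr[\mathcal{M}(\mathcal{D}')\in\mathcal{O}]+\delta$ for all datasets $\mathcal{D},\mathcal{D}'$ differing in one sample and all measurable output sets $\mathcal{O}$. ''Sample-level DP against clients'' means the mechanism mapping the union of the clients' datasets to $\mathbf{g}$ (with randomness from Poisson sampling and from the $v_{i,j},U_{i,j}$, which are hidden) satisfies this definition, where neighboring datasets differ in a single data sample. The loss gradient $\nabla\ell(\mathbf{w}_t,d)$ is the gradient of the per-sample loss with respect to the current model parameters $\mathbf{w}_t\in\mathbb{R}^m$. *)

(* Defs.v *)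
From HB Require Import structures.
From mathcomp Require Import all_boot all_order all_algebra.
From mathcomp Require Import all_classical all_reals all_analysis.

Set Implicit Arguments.
Unset Strict Implicit.
Unset Printing Implicit Defensive.

Import Order.TTheory GRing.Theory Num.Def Num.Theory.

Local Open Scope classical_set_scope.
Local Open Scope ring_scope.

Section fl_defs.
Context {R : realType}.

Definition Gamma_fn (k : R) : R :=
  fine (\int[lebesgue_measure]_(t in `]0%R, +oo[) ((t `^ (k - 1)) * expR (- t))%:E)%E.

Definition gamma_pdf (k theta : R) (x : R) : R :=
  if 0 < x then theta `^ k / Gamma_fn k * x `^ (k - 1) * expR (- (theta * x)) else 0.

Definition gamma_prob (k theta : R) (A : set R) : \bar R :=
  (\int[lebesgue_measure]_(x in A) (gamma_pdf k theta x)%:E)%E.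

Definition unif_prob (a b : R) (A : set R) : \bar R :=
  (\int[lebesgue_measure]_(x in A) (uniform_pdf a b x)%:E)%E.

Definition Phi (x : R) : R := fine (normal_prob 0 1 `]-oo, x]).

(** Rounding to the nearest integer (ties rounded up). *)
Definition round_nearest (x : R) : R := (Num.floor (x + 2^-1))%:~R.

Definition quantize (Delta x : R) : R :=
  round_nearest ((x - Delta / 2) / Delta) * Delta + Delta / 2.

Definition l2norm (m : nat) (x : 'I_m -> R) : R := Num.sqrt (\sum_(j < m) x j ^+ 2).

Definition clip (C : R) (m : nat) (x : 'I_m -> R) : 'I_m -> R :=
  fun j => x j / Num.max 1 (l2norm x / C).

Section protocol.
Variables (N m : nat) (S : finType) (own : S -> 'I_N) (Dat : Type)
  (grad : Dat -> 'I_m -> R) (C sigma B : R) (T : Type)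
  (b : S -> T -> R) (v W : 'I_N -> 'I_m -> T -> R).

(** local (clipped, averaged) gradient  \bar g_{i,t}; b s w in {0,1} is the
    Poisson-sampling indicator of sample slot s. *)
Definition local_grad (D : S -> Dat) (i : 'I_N) (j : 'I_m) (w : T) : R :=
  B^-1 * \sum_(s | own s == i) b s w * clip C (grad (D s)) j.

Definition Delta (i : 'I_N) (j : 'I_m) (w : T) : R := 2 * sigma * Num.sqrt (v i j w).

(** U_{i,j} = Delta_{i,j} * W_{i,j}, W_{i,j} ~ Unif(-1/2,1/2). *)
Definition dither (i : 'I_N) (j : 'I_m) (w : T) : R := Delta i j w * W i j w.

Definition ps_estimate (D : S -> Dat) (i : 'I_N) (j : 'I_m) (w : T) : R :=
  quantize (Delta i j w) (local_grad D i j w + dither i j w) - dither i j w.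

Definition fl_output (D : S -> Dat) (w : T) : 'I_m -> R :=
  fun j => N%:R^-1 * \sum_(i < N) ps_estimate D i j w.

Definition avg_local_grad (D : S -> Dat) (w : T) : 'I_m -> R :=
  fun j => N%:R^-1 * \sum_(i < N) local_grad D i j w.

Definition fl_family (k : (S + ('I_N * 'I_m)) + ('I_N * 'I_m)) : T -> R :=
  match k with
  | inl (inl s) => b s
  | inl (inr ij) => v ij.1 ij.2
  | inr ij => W ij.1 ij.2
  end.

End protocol.

Definition mutually_independent (d : measure_display) (T : measurableType d)
  (P : probability T R) (I : finType) (X : I -> T -> R) : Prop :=
  forall A : I -> set R, (forall i, measurable (A i)) ->
    P (\bigcap_i (X i @^-1` A i)) = (\prod_(i : I) P (X i @^-1` A i))%E.

Definition rect_sets (m : nat) : set (set ('I_m -> R)) :=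
  [set O | exists A : 'I_m -> set R, (forall j, measurable (A j)) /\
                         O = \bigcap_j ((fun x : 'I_m -> R => x j) @^-1` A j)].

Definition vec_measurable (m : nat) (O : set ('I_m -> R)) : Prop :=
  <<s (@rect_sets m) >> O.

(** Datasets: the union of the clients' datasets is a map from sample slots
    to samples; neighbouring datasets differ in a single sample. *)
Definition neighbouring (S : finType) (Dat : Type) (D D' : S -> Dat) : Prop :=
  exists s0 : S, forall s, s != s0 -> D s = D' s.

Definition sample_dp (d : measure_display) (T : measurableType d)
  (P : probability T R) (S : finType) (Dat : Type) (m : nat)
  (M : (S -> Dat) -> T -> ('I_m -> R)) (eps delta : R) : Prop :=
  forall D D' : S -> Dat, neighbouring D D' ->
  forall O : set ('I_m -> R), vec_measurable O ->
    (P (M D @^-1` O) <= (expR eps)%:E * P (M D' @^-1` O) + delta%:E)%E.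

End fl_defs.

(* Main.v *)
(** Dithered quantization of a fixed value [x] with step [D] has an error that is
    uniform on ]-D/2, D/2[ whatever [x] is; when [D = 2 sigma sqrt v] with
    [v ~ Gamma(3/2, 1/2)], mixing these uniform laws over [v] gives exactly
    N(0, sigma^2).  Conditionally on the batch the local gradients are
    constants, so the averaged error is N(0, sigma^2 / N) in each coordinate,
    independently over coordinates and of the batch.

    For privacy, condition on the batch outside the differing slot [s0].  By the
    Cameron-Martin formula the likelihood ratio of two translates of the
    Gaussian noise is a function of one linear form, hence the worst event is a
    half-space, and its probabilities are values of [Phi].  The shift is at most
    [2 C / (N B)] between the two data sets when [s0] is sampled, and at most
    [C / (N B)] between "sampled" and "not sampled"; combining both comparisons
    gives the amplification by subsampling. *)

Require Import Defs.
From HB Require Import structures.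
From mathcomp Require Import all_boot all_order all_algebra.
From mathcomp Require Import all_classical all_reals all_analysis.
From mathcomp Require Import measurable_realfun ring lra.

Set Implicit Arguments.
Unset Strict Implicit.
Unset Printing Implicit Defensive.

Import Order.TTheory GRing.Theory Num.Def Num.Theory.
Import numFieldNormedType.Exports.

Local Open Scope classical_set_scope.
Local Open Scope ring_scope.

(** * Independence *)

(** The actual noise is not a function of the [v] and [W] alone: through rounding it also depends on
    the batch, so its independence of the batch cannot be read off from disjoint groups of
    variables. One reference noise therefore serves all batches and both data sets, and the law of
    the output is a finite mixture of translates of a single Gaussian vector. No density on vectors
    is ever formed: the likelihood ratio of two translates is a random variable on [T], used as a
    density with respect to [P], and equalities between laws of vectors are checked on
    rectangles. *)

Section independence.
Context {R : realType} {d : measure_display} {T : measurableType d}.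
Variable P : probability T R.

Lemma fin_bigcap_measurableT (I : finType) (D : set I) (A : I -> set T) :
  (forall i, measurable (A i)) -> measurable (\bigcap_(i in D) A i).
Proof.
by move=> mA; apply: fin_bigcap_measurable => // i _; exact: mA.
Qed.

Lemma bigcap_split1 (I : finType) (U : Type) (k : I) (A : I -> set U) :
  \bigcap_i A i = A k `&` \bigcap_(i in [set i | i != k]) A i.
Proof.
apply/seteqP; split => [x Ax|x [Akx Ax] i _].
  by split=> [|i _]; exact: Ax.
by have [->//|ik] := eqVneq i k; exact: Ax.
Qed.

(* One coordinate at a time, both sides are finite measures in the event that
   is being upgraded from [G k] to the sigma-algebra it generates. *)
Lemma independence_generated (I : finType) (G : I -> set (set T)) :
  (forall i, G i `<=` measurable) -> (forall i, setI_closed (G i)) ->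
  (forall i, G i setT) ->
  (forall A, (forall i, G i (A i)) ->
     P (\bigcap_i A i) = (\prod_(i : I) P (A i))%E) ->
  forall A, (forall i, <<s G i >> (A i)) ->
     P (\bigcap_i A i) = (\prod_(i : I) P (A i))%E.
Proof.
move=> Gm GI GT GP.
have sGm i : <<s G i >> `<=` measurable.
  exact: smallest_sub (@sigma_algebra_measurable _ T) (Gm i).
suff H (s : seq I) A : (forall i, i \in s -> <<s G i >> (A i)) ->
    (forall i, i \notin s -> G i (A i)) ->
    P (\bigcap_i A i) = (\prod_(i : I) P (A i))%E.
  move=> A sA; apply: (H (enum I)) => i; first by move=> _; exact: sA.
  by rewrite mem_enum.
elim: s A => [|k s IHs] A sA GA; first by apply: GP => i; exact: GA.
have [ks|ks] := boolP (k \in s).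
  apply: IHs => i ins; first by apply: sA; rewrite inE ins orbT.
  by apply: GA; rewrite inE negb_or ins andbT; apply/eqP => ik;
    rewrite ik ks in ins.
have mA i : measurable (A i).
  have [ins|ins] := boolP (i \in k :: s); first by apply: sGm; exact: sA.
  by apply: Gm; exact: GA.
pose F := \bigcap_(i in [set i | i != k]) A i.
have mF : measurable F by exact: fin_bigcap_measurableT.
pose c := (\prod_(i | i != k) fine (P (A i)))%R.
have c0 : 0 <= c by apply: prodr_ge0 => i _; exact: fine_ge0.
have cE : (\prod_(i | i != k) P (A i) = c%:E)%E.
  rewrite /c -prodEFin; apply: eq_bigr => i _; rewrite fineK//.
  exact: fin_num_measure.
rewrite (bigcap_split1 k) (bigD1 k)//= cE muleC.
have -> : P (A k `&` F) = mrestr P mF (A k) by [].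
have -> : (c%:E * P (A k) = mscale (NngNum c0) P (A k))%E by [].
apply: (g_sigma_algebra_measure_unique (G k) (Gm k) (fun=> setT)) => //.
- by rewrite bigcup_const.
- move=> B GB; rewrite /= /mrestr /mscale/= muleC -cE.
  pose A' i := if i == k then B else A i.
  have FE : F = \bigcap_(i in [set i | i != k]) A' i.
    by apply: eq_bigcapr => i /= /negbTE ik; rewrite /A' ik.
  have -> : (\prod_(i | i != k) P (A i) = \prod_(i | i != k) P (A' i))%E.
    by apply: eq_bigr => i /negbTE ik; rewrite /A' ik.
  have -> : B = A' k by rewrite /A' eqxx.
  rewrite FE -bigcap_split1 IHs; first by rewrite (bigD1 k).
    move=> i ins; rewrite /A'; case: eqP => [ik|_].
      by rewrite -ik ins in ks.
    by apply: sA; rewrite inE ins orbT.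
  move=> i ins; rewrite /A'; case: eqP => [->//|/eqP ik].
  by apply: GA; rewrite inE negb_or ik.
- move=> _; rewrite /= /mrestr setTI.
  by rewrite (le_lt_trans (probability_le1 P mF))// ltry.
- by apply: sA; rewrite inE eqxx.
Qed.

(** A π-system generating the sigma-algebra of the variables indexed by [D]. Measurability with
    respect to it expresses that a function depends only on those variables. *)
Definition cylinders (K : finType) (X : K -> T -> R) (D : set K) :
    set (set T) :=
  [set B | exists2 A : K -> set R, forall k, measurable (A k) &
           B = \bigcap_(k in D) (X k @^-1` A k)].

Lemma cylinders_measurable (K : finType) (X : K -> T -> R) (D : set K) :
  (forall k, measurable_fun setT (X k)) -> cylinders X D `<=` measurable.
Proof.
move=> mX _ [A mA ->]; apply: fin_bigcap_measurableT => k.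
by rewrite -[_ @^-1` _]setTI; exact: mX.
Qed.

Lemma cylinders_setI (K : finType) (X : K -> T -> R) (D : set K) :
  setI_closed (cylinders X D).
Proof.
move=> _ _ [A mA ->] [B mB ->]; exists (fun k => A k `&` B k).
  by move=> k; exact: measurableI.
apply/seteqP; split=> [x [Ax Bx] k Dk|x ABx]; first by split;
  [exact: Ax|exact: Bx].
by split=> k Dk; have [] := ABx _ Dk.
Qed.

Lemma cylindersT (K : finType) (X : K -> T -> R) (D : set K) :
  cylinders X D setT.
Proof.
exists (fun=> setT) => //.
by apply/esym; rewrite -subTset => x _ k _.
Qed.

Lemma measurable_fun_cylinders (K : finType) (X : K -> T -> R) (D : set K) k :
  D k ->
  measurable_fun (setT : set (g_sigma_algebraType (cylinders X D))) (X k).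
Proof.
move=> Dk _ A mA; rewrite setTI; apply: sub_sigma_algebra.
exists (fun k' => if k' == k then A else setT).
  by move=> k'; case: ifP.
apply/seteqP; split => [x Ax k' _ /=|x /(_ _ Dk)] /=; last by rewrite eqxx.
by case: eqP => [->//|].
Qed.

(** Block independence: [f] assigns each variable to a block, or discards it with [None]. For
    cylinders the product rule is a regrouping of the product over [K]; [independence_generated]
    extends it to everything measurable with respect to the blocks. *)
Lemma mutually_independent_group (K I : finType) (X : K -> T -> R)
    (f : K -> option I) (F : I -> T -> R) :
  (forall k, measurable_fun setT (X k)) ->
  mutually_independent P X ->
  (forall i, measurable_fun
     (setT : set (g_sigma_algebraType (cylinders X [set k | f k = Some i])))
     (F i)) ->
  mutually_independent P F.
Proof.
move=> mX iX mF A mA.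
pose G i := cylinders X [set k | f k = Some i].
apply: (@independence_generated I G) => [i|i|i|B GB|i].
- exact: cylinders_measurable.
- exact: cylinders_setI.
- exact: cylindersT.
- have /boolp.choice[A0 A0P] : forall i, exists A0 : K -> set R,
      (forall k, measurable (A0 k)) /\
      B i = \bigcap_(k in [set k | f k = Some i]) (X k @^-1` A0 k).
    by move=> i; have [A0 ? ?] := GB i; exists A0.
  have PB i : P (B i) = (\prod_(k | f k == Some i) P (X k @^-1` A0 i k))%E.
    have [mA0 ->] := A0P i.
    transitivity (P (\bigcap_k (X k @^-1`
        (if f k == Some i then A0 i k else setT)))).
      congr (P _); apply/seteqP; split => [x Ax k _|x Ax k /= fki] /=.
        by case: eqP => // fki; exact: Ax.
      by have := Ax k Logic.I; rewrite /= fki eqxx.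
    rewrite iX; last by move=> k; case: ifP.
    rewrite [RHS]big_mkcond; apply: eq_bigr => k _.
    by case: ifP => // _; rewrite preimage_setT probability_setT.
  under [RHS]eq_bigr do rewrite PB.
  (* The blocks are disjoint, so the constraints of all blocks glue into one family indexed by [K];
     discarded variables are unconstrained. *)
  pose A1 k := if f k is Some i then A0 i k else setT.
  transitivity (P (\bigcap_k (X k @^-1` A1 k))).
    congr (P _); apply/seteqP; split => [x Bx k _|x Ax i _] /=.
      rewrite /A1; case fk : (f k) => [i|//].
      by have := Bx i Logic.I; have [_ ->] := A0P i; exact.
    have [_ ->] := A0P i => k /= fki.
    by have := Ax k Logic.I; rewrite /A1/= fki.
  rewrite iX; last by move=> k; rewrite /A1; case: (f k) => // i;
    have [] := A0P i.
  under [RHS]eq_bigr do rewrite big_mkcond.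
  rewrite [RHS]exchange_big/=; apply: eq_bigr => k _.
  rewrite /A1; case fk : (f k) => [i|]; last first.
    by rewrite preimage_setT probability_setT big1.
  rewrite (bigD1 i)//= eqxx big1 ?mule1// => j ji.
  by case: eqP => // -[ij]; rewrite ij eqxx in ji.
- by have := mF i measurableT _ (mA i); rewrite setTI.
Qed.

Lemma mutually_independent2 (K : finType) (X : K -> T -> R) (k l : K) A B :
  k != l -> mutually_independent P X -> measurable A -> measurable B ->
  P (X k @^-1` A `&` X l @^-1` B) = (P (X k @^-1` A) * P (X l @^-1` B))%E.
Proof.
move=> kl iX mA mB.
pose C j := if j == k then A else if j == l then B else setT.
have lk : (l == k) = false by rewrite eq_sym; exact/negbTE.
transitivity (P (\bigcap_j (X j @^-1` C j))).
  congr (P _); apply/seteqP; split => [x [Ax Bx] j _ /=|x Cx]; rewrite /C.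
    by case: eqP => [->//|_]; case: eqP => [->|].
  split; first by have := Cx k Logic.I; rewrite /C/= eqxx.
  by have := Cx l Logic.I; rewrite /C/= eqxx lk.
rewrite iX; last by move=> j; rewrite /C; case: ifP => // _; case: ifP.
rewrite (bigD1 k)//= (bigD1 l) 1?eq_sym//= /C eqxx lk eqxx big1 ?mule1//.
by move=> j /andP[/negbTE -> /negbTE ->];
  rewrite preimage_setT probability_setT.
Qed.

End independence.

(** * Change of variables and densities *)

Section lebesgue_affine.
Context {R : realType}.
Notation mu := (@lebesgue_measure R).

Lemma measurable_affine (a b : R) :
  measurable_fun setT (fun x : R => a * x + b).
Proof. by apply: measurable_funD => //; exact: measurable_funM. Qed.

Lemma affine_preimage_oc (a b x y : R) : 0 < a ->
  (fun z : R => a * z + b) @^-1` `]x, y] = `](x - b) / a, (y - b) / a]%classic.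
Proof.
move=> a0; apply/seteqP; split => z /=; rewrite !in_itv/=;
  by rewrite ltr_pdivrMr// ler_pdivlMr// ltrBlDr lerBrDr mulrC.
Qed.

(** Lebesgue measure is determined by the lengths of half-open intervals, and [a] times its image
    under the affine map gives them the same lengths. *)
Lemma ge0_integral_affine (a b : R) (h : R -> \bar R) : 0 < a ->
  measurable_fun setT h -> (forall x, 0 <= h x)%E ->
  (\int[mu]_x h x = a%:E * \int[mu]_x h (a * x + b)%R)%E.
Proof.
move=> a0 mh h0; have a0' := ltW a0.
pose phi (x : R) : measurableTypeR R := (a * x + b)%R.
have mphi : measurable_fun setT phi by exact: measurable_affine.
have -> : (\int[mu]_x h (a * x + b)%R = \int[pushforward mu phi]_y h y)%E.
  by rewrite ge0_integral_pushforward.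
rewrite -(@ge0_integral_mscale _ _ R (pushforward mu phi)
  setT measurableT (NngNum a0'))//=.
apply: eq_measure_integral => A mA _.
apply: lebesgue_measure_unique => //= _ [[x y]] _ <-.
rewrite /mscale/= /pushforward affine_preimage_oc// !lebesgue_measure_itv/=.
rewrite !lte_fin ltr_pM2r ?invr_gt0// ltrD2r; case: ifP => _;
  last by rewrite mule0.
by rewrite !EFinN -!EFinD -EFinM; congr EFin; field; rewrite gt_eqF.
Qed.

Lemma ge0_integral_shift (b : R) (h : R -> \bar R) :
  measurable_fun setT h -> (forall x, 0 <= h x)%E ->
  (\int[mu]_x h x = \int[mu]_x h (x + b)%R)%E.
Proof.
move=> mh h0; rewrite (ge0_integral_affine b ltr01)// mul1e.
by apply: eq_integral => x _; rewrite mul1r.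
Qed.

End lebesgue_affine.

Section density.
Context {R : realType} {d : measure_display} {T : measurableType d}.
Variables (mu nu : {measure set T -> \bar R}) (f : T -> R).
Hypothesis mf : measurable_fun setT f.
Hypothesis f0 : forall x, 0 <= f x.
Hypothesis nuE : forall A,
  measurable A -> nu A = (\int[mu]_(x in A) (f x)%:E)%E.

Import HBNNSimple.

Let integral_density_nnsfun (h : {nnsfun T >-> R}) :
  (\int[nu]_x (h x)%:E = \int[mu]_x ((h x)%:E * (f x)%:E))%E.
Proof.
under [LHS]eq_integral do rewrite fimfunE -fsumEFin//.
rewrite [LHS]ge0_integral_fsum//; last 2 first.
  - by move=> r; exact/measurable_EFinP/measurableT_comp.
  - by move=> n x _; rewrite EFinM nnfun_muleindic_ge0.
under [RHS]eq_integral.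
  move=> x xD; rewrite fimfunE -fsumEFin// ge0_mule_fsuml; last first.
    by move=> r; rewrite EFinM nnfun_muleindic_ge0.
  over.
rewrite [RHS]ge0_integral_fsum//; last 2 first.
  - by move=> r; apply: emeasurable_funM; apply/measurable_EFinP => //;
    exact/measurableT_comp.
  - by move=> n x _; rewrite mule_ge0 ?[(0 <= (f x)%:E)%E]lee_fin// EFinM
    nnfun_muleindic_ge0.
apply: eq_fsbigr => r _.
have mh : measurable (h @^-1` [set r]) by [].
under [RHS]eq_integral do rewrite EFinM -muleA.
have [r0|r0] := ltP r 0.
  have h0 : h @^-1` [set r] = set0 by exact: preimage_nnfun0.
  rewrite h0 !integral0_eq// => x _; first by rewrite indic0 mul0e mule0.
  by rewrite indic0 mulr0.
rewrite integralZl_indic_nnsfun//= ge0_integralZl//=; last 2 first.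
  - by apply: emeasurable_funM; apply/measurable_EFinP.
  - by move=> x _; rewrite mule_ge0// lee_fin.
congr (_ * _)%E; rewrite integral_indic// setIT nuE// integral_mkcond.
apply: eq_integral => x _; rewrite patchE indicE.
by case: ifP => _; rewrite ?mul1e ?mul0e.
Qed.

(** Simple functions reduce the claim to the formula [nuE] for sets; monotone convergence does the
    rest. *)
Lemma ge0_integral_density (h : T -> \bar R) :
  measurable_fun setT h -> (forall x, 0 <= h x)%E ->
  (\int[nu]_x h x = \int[mu]_x (h x * (f x)%:E))%E.
Proof.
move=> mh h0.
pose h_ := nnsfun_approx measurableT mh.
transitivity (lim (\int[nu]_x (h_ n x)%:E @[n --> \oo])%E).
  rewrite -monotone_convergence//=.
  - apply: eq_integral => ? /[!inE] xD; apply/esym/cvg_lim => //=.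
    exact: cvg_nnsfun_approx.
  - by move=> n; exact/measurable_EFinP/measurable_funTS.
  - by move=> n ? _; rewrite lee_fin.
  - by move=> ? _ ? ? mn; rewrite lee_fin; exact/lefP/nd_nnsfun_approx.
rewrite (_ : (fun n => _) =
    fun n => (\int[mu]_x ((h_ n x)%:E * (f x)%:E))%E); last first.
  by apply/funext => n; exact: integral_density_nnsfun.
rewrite -monotone_convergence//=.
- apply: eq_integral => x _; apply/cvg_lim => //=.
  by apply: cvgeMr => //; exact: cvg_nnsfun_approx.
- by move=> n; apply: emeasurable_funM; apply/measurable_EFinP.
- by move=> n x _; rewrite mule_ge0// lee_fin.
- move=> x _ a b ab; apply: lee_wpmul2r; first by rewrite lee_fin.
  by rewrite lee_fin; exact/lefP/nd_nnsfun_approx.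
Qed.

End density.

Section independent_pair.
Context {R : realType} {d d1 d2 : measure_display} {T : measurableType d}
  {T1 : measurableType d1} {T2 : measurableType d2}.
Variables (P : probability T R) (X : T -> T1) (Y : T -> T2).
Hypotheses (mX : measurable_fun setT X) (mY : measurable_fun setT Y).
Hypothesis iXY : forall A B, measurable A -> measurable B ->
  P (X @^-1` A `&` Y @^-1` B) = (P (X @^-1` A) * P (Y @^-1` B))%E.

(** By uniqueness of product measures, [iXY] makes the joint law the product of the two laws;
    Tonelli's theorem then applies. *)
Lemma ge0_integral_independent_pair (h : T1 * T2 -> \bar R) :
  measurable_fun setT h -> (forall x, 0 <= h x)%E ->
  (\int[P]_w h (X w, Y w) =
   \int[pushforward P X]_x \int[pushforward P Y]_y h (x, y))%E.
Proof.
move=> mh h0.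
pose X' : {RV P >-> T1} := HB.pack X (isMeasurableFun.Build _ _ _ _ _ mX).
pose Y' : {RV P >-> T2} := HB.pack Y (isMeasurableFun.Build _ _ _ _ _ mY).
pose Z w := (X w, Y w).
have mZ : measurable_fun setT Z by exact: measurable_fun_pair.
pose Z' : {RV P >-> (T1 * T2)%type} :=
  HB.pack Z (isMeasurableFun.Build _ _ _ _ _ mZ).
transitivity (\int[distribution P Z']_z h z)%E.
  by rewrite ge0_integral_distribution.
transitivity (\int[(distribution P X') \x (distribution P Y')]_z h z)%E.
  apply: eq_measure_integral => A mA _.
  exact/esym/product_measure_unique.
by rewrite fubini_tonelli1.
Qed.

End independent_pair.

Section independent_density.
Context {R : realType} {d : measure_display} {T : measurableType d}.
Variables (P : probability T R) (X Y : T -> R).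
Hypotheses (mX : measurable_fun setT X) (mY : measurable_fun setT Y).
Hypothesis iXY : forall A B : set R, measurable A -> measurable B ->
  P (X @^-1` A `&` Y @^-1` B) = (P (X @^-1` A) * P (Y @^-1` B))%E.
Notation mu := (@lebesgue_measure R).

Lemma ge0_expectation_independentM :
  (forall w, 0 <= X w) -> (forall w, 0 <= Y w) ->
  (\int[P]_w (X w * Y w)%:E =
   (\int[P]_w (X w)%:E) * (\int[P]_w (Y w)%:E))%E.
Proof.
move=> X0 Y0.
(* Truncation at 0 makes the integrand nonnegative on the whole plane and changes nothing at the
   values taken by [X] and [Y]. *)
pose h (z : R * R) : \bar R := (Num.max 0 z.1 * Num.max 0 z.2)%:E.
have mx : measurable_fun setT (fun x : R => Num.max 0 x).
  exact: measurable_maxr.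
have maxE (x : R) : 0 <= x -> Num.max 0 x = x by move=> x0; rewrite max_r.
have max0 (x : R) : (0 <= (Num.max 0 x)%:E)%E by rewrite lee_fin le_max lexx.
transitivity (\int[P]_w h (X w, Y w))%E.
  by apply: eq_integral => w _; rewrite /h/= !maxE.
rewrite ge0_integral_independent_pair//; last 2 first.
- apply/measurable_EFinP; apply: measurable_funM; exact: measurableT_comp.
- by move=> x; rewrite lee_fin mulr_ge0// le_max lexx.
under eq_integral => x _.
  under eq_integral do rewrite /h/= EFinM.
  rewrite ge0_integralZl//; first over.
  exact/measurable_EFinP.
rewrite ge0_integralZr//; last 2 first.
- exact/measurable_EFinP.
- exact: integral_ge0.
rewrite !ge0_integral_pushforward//=; try exact/measurable_EFinP.
by congr (_ * _)%E; apply: eq_integral => w _; rewrite /= maxE.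
Qed.

Lemma ge0_integral_independent_density (f g : R -> R) (h : R * R -> \bar R) :
  measurable_fun setT f -> (forall x, 0 <= f x) ->
  measurable_fun setT g -> (forall x, 0 <= g x) ->
  (forall A : set R, measurable A ->
    P (X @^-1` A) = \int[mu]_(x in A) (f x)%:E)%E ->
  (forall A : set R, measurable A ->
    P (Y @^-1` A) = \int[mu]_(x in A) (g x)%:E)%E ->
  measurable_fun setT h -> (forall x, 0 <= h x)%E ->
  (\int[P]_w h (X w, Y w) =
   \int[mu]_x \int[mu]_y (h (x, y) * (g y)%:E * (f x)%:E))%E.
Proof.
move=> mf f0 mg g0 PX PY mh h0.
pose T1 := measurableTypeR R.
rewrite (@ge0_integral_independent_pair _ _ _ _ _ T1 T1)//.
pose X' : {RV P >-> T1} := HB.pack X (isMeasurableFun.Build _ _ _ T1 _ mX).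
pose Y' : {RV P >-> T1} := HB.pack Y (isMeasurableFun.Build _ _ _ T1 _ mY).
have mh1 x : measurable_fun (setT : set T1) (fun y : T1 => h (x, y)).
  by apply: (@measurableT_comp _ _ _ _ (T1 * T1)%type) => //;
    exact: measurable_fun_pair.
under eq_integral => x _.
  rewrite (@ge0_integral_density _ _ _ mu (distribution P Y') g)//; over.
rewrite (@ge0_integral_density _ _ _ mu (distribution P X') f)//=.
- apply: eq_integral => x _; rewrite -ge0_integralZr//.
  + by apply: emeasurable_funM => //; exact/measurable_EFinP.
  + by move=> y _; rewrite mule_ge0// lee_fin.
  + by rewrite lee_fin.
- apply: (@measurable_fun_fubini_tonelli_F _ _ _ _ _ mu
    (fun z => h z * (g z.2)%:E)%E).
  + apply: emeasurable_funM => //; apply/measurable_EFinP.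
    exact: measurableT_comp.
  + by move=> z; rewrite mule_ge0// lee_fin.
- by move=> x; apply: integral_ge0 => y _; rewrite mule_ge0// lee_fin.
Qed.

End independent_density.

(** * Normal laws *)

Section normal.
Context {R : realType}.
Notation mu := (@lebesgue_measure R).

Lemma integral_indicM {d} {U : measurableType d} (nu : {measure set U -> \bar
  R})
    (A : set U) (f : U -> \bar R) :
  (\int[nu]_(x in A) f x = \int[nu]_x ((\1_A x)%:E * f x))%E.
Proof.
rewrite integral_mkcond; apply: eq_integral => x _; rewrite patchE indicE.
by case: ifP => _; rewrite ?mul1e ?mul0e.
Qed.

Lemma ge0_integralN (h : R -> \bar R) :
  measurable_fun setT h -> (forall x, 0 <= h x)%E ->
  (\int[mu]_x h x = \int[mu]_x h (- x)%R)%E.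
Proof.
move=> mh h0.
have -> : (\int[mu]_x h (- x)%R =
    \int[pushforward mu (-%R : _ -> measurableTypeR R)]_y h y)%E.
  by rewrite ge0_integral_pushforward.
by apply: eq_measure_integral => A mA _; exact/esym/lebesgue_measureN.
Qed.

Lemma ge0_integral_affine_neq0 (a b : R) (h : R -> \bar R) : a != 0 ->
  measurable_fun setT h -> (forall x, 0 <= h x)%E ->
  (\int[mu]_x h x = `|a|%:E * \int[mu]_x h (a * x + b)%R)%E.
Proof.
move=> a0 mh h0; have [a_gt0|a_lt0|] := ltgtP a 0; last by move/eqP;
  rewrite (negbTE a0).
  rewrite ltr0_norm// (@ge0_integral_affine _ (- a) b)// ?oppr_gt0//.
  rewrite [in RHS]ge0_integralN//.
    by congr (_ * _)%E; apply: eq_integral => x _; rewrite mulrN mulNr.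
  by apply: measurableT_comp => //; exact: measurable_affine.
by rewrite gtr0_norm//; exact: ge0_integral_affine.
Qed.

Lemma normal_peakM (a s : R) : normal_peak (a * s) = normal_peak s / `|a|.
Proof.
rewrite /normal_peak exprMn -mulrA -mulrnAr sqrtrM ?sqr_ge0// sqrtr_sqr.
by rewrite invfM mulrC.
Qed.

Lemma normal_prob_affine (a c s : R) (A : set R) : a != 0 -> s != 0 ->
  measurable A ->
  normal_prob 0 s ((fun x => a * x + c) @^-1` A) = normal_prob c (a * s) A.
Proof.
move=> a0 s0 mA; rewrite /normal_prob [LHS]integral_indicM [RHS]integral_indicM.
have as0 : a * s != 0 by rewrite mulf_neq0.
rewrite [RHS](@ge0_integral_affine_neq0 a c)//; last 2 first.
- by apply: emeasurable_funM; apply/measurable_EFinP => //;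
  exact: measurable_normal_pdf.
- by move=> x; rewrite mule_ge0// lee_fin ?normal_pdf_ge0.
rewrite -ge0_integralZl//; last 2 first.
- apply: (@measurableT_comp _ _ _ _ _ _ (fun x : R =>
  (\1_A x)%:E * (normal_pdf c (a * s) x)%:E)%E).
    by apply: emeasurable_funM; apply/measurable_EFinP => //;
      exact: measurable_normal_pdf.
  exact: measurable_affine.
- by move=> x _; rewrite mule_ge0// lee_fin ?normal_pdf_ge0.
apply: eq_integral => x _; rewrite muleCA -!EFinM; congr (_ * _)%:E.
rewrite !normal_pdfE// normal_peakM mulrA mulrCA divff ?normr_eq0// mulr1.
by congr (_ * expR _); rewrite addrK subr0; field; rewrite a0 s0.
Qed.

(** Scale parameters arise as products such as [a * s] and may be negative; only the variance
    matters. *)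
Lemma normal_prob_abs (s : R) (A : set R)
  : normal_prob 0 `|s| A = normal_prob 0 s A.
Proof.
rewrite /normal_prob; apply: eq_integral => x _; congr EFin.
by rewrite /normal_pdf normr_eq0 /normal_peak /normal_fun real_normK ?num_real.
Qed.

(* Completing the square in [y]. *)
Lemma normal_pdf_conv (s t x y : R) : s != 0 -> t != 0 ->
  let u := Num.sqrt (s ^+ 2 + t ^+ 2) in
  normal_pdf 0 s (x - y) * normal_pdf 0 t y =
  normal_pdf 0 u x * normal_pdf (x * t ^+ 2 / u ^+ 2) (s * t / u) y.
Proof.
move=> s0 t0 u.
have u2 : u ^+ 2 = s ^+ 2 + t ^+ 2 by rewrite sqr_sqrtr// addr_ge0// sqr_ge0.
have u2_gt0 : 0 < u ^+ 2 by rewrite u2 addr_gt0// exprn_even_gt0.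
have u0 : u != 0 by rewrite -sqrf_eq0 gt_eqF.
have st0 : s * t / u != 0 by rewrite mulf_neq0 ?invr_eq0// mulf_neq0.
rewrite !normal_pdfE// mulrACA [RHS]mulrACA; congr (_ * _).
  have pE (r : R) : normal_peak r = normal_peak 1 / `|r|.
    by rewrite -{1}(mulr1 r) normal_peakM.
  rewrite !(pE s, pE t, pE u, pE (s * t / u)) normrM normfV normrM.
  by field; rewrite !normr_eq0 s0 t0 u0.
rewrite /normal_fun -!expRD; congr expR.
rewrite !subr0.
have -> : (s * t / u) ^+ 2 = s ^+ 2 * t ^+ 2 / u ^+ 2 by rewrite !exprMn exprVn.
rewrite u2; rewrite u2 in u2_gt0; field.
by rewrite s0 t0/= gt_eqF.
Qed.

Definition normal_rv {d} {T : measurableType d} (P : probability T R)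
    (X : T -> R) (s : R) : Prop :=
  forall A : set R, measurable A -> P (X @^-1` A) = normal_prob 0 s A.

Context {d : measure_display} {T : measurableType d} (P : probability T R).

Lemma normal_rvZ (X : T -> R) (a s : R) : a != 0 -> s != 0 ->
  normal_rv P X s -> normal_rv P (fun w => a * X w) (a * s).
Proof.
move=> a0 s0 nX A mA; rewrite -normal_prob_affine//.
rewrite -nX.
  by congr (P _); apply/seteqP; split => w /=; rewrite addr0.
by rewrite -[X in measurable X]setTI; exact: measurable_affine.
Qed.

Lemma probability_integral_indic (X : T -> R) (A : set R) :
  measurable_fun setT X -> measurable A ->
  (P (X @^-1` A) = \int[P]_w (\1_A (X w))%:E)%E.
Proof.
move=> mX mA; rewrite -[X in P X]setIT -integral_indic//.
by rewrite -[X in measurable X]setTI; exact: mX.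
Qed.

(** For fixed [y] a translation makes the value of the sum the integration variable [x]. After
    exchanging the integrals, [normal_pdf_conv] leaves a normal density in [y], of total mass
    one. *)
Lemma normal_rvD (X Y : T -> R) (s t : R) : s != 0 -> t != 0 ->
  measurable_fun setT X -> measurable_fun setT Y ->
  (forall A B : set R, measurable A -> measurable B ->
    P (X @^-1` A `&` Y @^-1` B) = (P (X @^-1` A) * P (Y @^-1` B))%E) ->
  normal_rv P X s -> normal_rv P Y t ->
  normal_rv P (fun w => X w + Y w) (Num.sqrt (s ^+ 2 + t ^+ 2)).
Proof.
move=> s0 t0 mX mY iXY nX nY A mA; set u := Num.sqrt _.
have mp m r : measurable_fun setT (fun x : R => (normal_pdf m r x)%:E).
  by apply/measurable_EFinP; exact: measurable_normal_pdf.
have p0 (m r x : R) : (0 <= (normal_pdf m r x)%:E)%E by rewrite lee_fin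
  normal_pdf_ge0.
have mA1 : measurable_fun setT (fun x : R =>
  (\1_A x)%:E : \bar R) by exact/measurable_EFinP.
pose h (z : R * R) : \bar R := (\1_A (z.2 + z.1))%:E.
have mh : measurable_fun setT h.
  by apply: measurableT_comp mA1 _; exact: measurable_funD.
have h0 z : (0 <= h z)%E by rewrite lee_fin.
transitivity (\int[P]_w h (Y w, X w))%E.
  by rewrite probability_integral_indic//; exact: measurable_funD.
rewrite (@ge0_integral_independent_density _ _ _ P Y X mY mX _
  (normal_pdf 0 t) (normal_pdf 0 s))//; try exact: measurable_normal_pdf;
    try exact: normal_pdf_ge0; last first.
  by move=> B C mB mC; rewrite setIC iXY// muleC.
transitivity (\int[mu]_y \int[mu]_x ((\1_A x)%:E * (normal_pdf 0 s (x -
  y)%R)%:E *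
   (normal_pdf 0 t y)%:E))%E.
  apply: eq_integral => y _; rewrite [RHS](ge0_integral_shift y).
  - by apply: eq_integral => x _; rewrite addrK.
  - apply: emeasurable_funM => //; apply: emeasurable_funM => //.
    by apply: measurableT_comp (mp _ _) _; exact: measurable_funB.
  - by move=> x; rewrite !mule_ge0// lee_fin.
pose k (z : R * R) := ((\1_A z.2)%:E * (normal_pdf 0 s (z.2 - z.1)%R)%:E *
   (normal_pdf 0 t z.1)%:E)%E.
rewrite (@fubini_tonelli _ _ _ _ _ mu mu k); last 2 first.
- apply: emeasurable_funM; last by apply: measurableT_comp (mp _ _) _.
  apply: emeasurable_funM; first by apply: measurableT_comp mA1 _.
  by apply: measurableT_comp (mp _ _) _; exact: measurable_funB.
- by move=> x; rewrite !mule_ge0// lee_fin.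
rewrite /normal_prob [RHS]integral_indicM; apply: eq_integral => x _;
  rewrite /k/=.
transitivity (\int[mu]_y ((\1_A x)%:E * (normal_pdf 0 u x)%:E *
    (normal_pdf (x * t ^+ 2 / u ^+ 2) (s * t / u) y)%:E))%E.
  by apply: eq_integral => y _; rewrite -!muleA -!EFinM normal_pdf_conv.
rewrite ge0_integralZl ?integral_normal_pdf ?mule1//.
- exact: mp.
- by rewrite mule_ge0// lee_fin.
Qed.

(* Variances are only added when positive: [normal_prob 0 0] is not a Dirac
   mass but the uniform law on [0, 1]. *)
Lemma normal_rv_sum (K : finType) (X : K -> T -> R) (a : K -> R) (t : R)
    (s : seq K) : t != 0 -> uniq s ->
  (forall k, measurable_fun setT (X k)) -> mutually_independent P X ->
  (forall k, normal_rv P (X k) t) ->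
  0 < \sum_(k <- s) a k ^+ 2 ->
  normal_rv P (fun w => \sum_(k <- s) a k * X k w)
    (t * Num.sqrt (\sum_(k <- s) a k ^+ 2)).
Proof.
move=> t0 + mX iX nX; elim: s => [|k s IHs] /=; first by rewrite big_nil ltxx.
move=> /andP[ks us]; rewrite big_cons.
have q0 : 0 <= \sum_(j <- s) a j ^+ 2 by apply: sumr_ge0 => j _; exact: sqr_ge0.
move: q0 IHs; set q := (\sum_(j <- s) a j ^+ 2) => q0 IHs aq0.
have -> : (fun w => \sum_(j <- k :: s) a j * X j w) =
    (fun w => a k * X k w + \sum_(j <- s) a j * X j w).
  by apply/funext => w; rewrite big_cons.
have [ak0|ak0] := eqVneq (a k) 0.
  rewrite ak0 expr0n/= add0r in aq0 *;
    have -> : (fun w => 0 * X k w + \sum_(j <- s) a j * X j w) = (fun w =>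
      \sum_(j <- s) a j * X j w).
    by apply/funext => w; rewrite mul0r add0r.
  exact: IHs.
move: q0; rewrite le_eqVlt => /predU1P[q0|q_gt0].
  have -> : (fun w => a k * X k w + \sum_(j <- s) a j * X j w) = (fun w =>
    a k * X k w).
    apply/funext => w; rewrite big_seq big1 ?addr0// => j js.
    have /eqP := esym q0; rewrite /q psumr_eq0; last by move=> ? _;
      exact: sqr_ge0.
    by move=> /allP/(_ _ js)/=; rewrite sqrf_eq0 => /eqP ->; rewrite mul0r.
  rewrite -q0 addr0 sqrtr_sqr => A mA.
  rewrite (normal_rvZ ak0 t0 (nX k) mA)
    -[LHS]normal_prob_abs -[RHS]normal_prob_abs.
  by rewrite !normrM normr_id mulrC.
have sq0 : Num.sqrt q != 0 by rewrite gt_eqF// sqrtr_gt0.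
have mS : measurable_fun setT (fun w => \sum_(j <- s) a j * X j w).
  by apply: measurable_sum => j; exact: measurable_funM.
move=> A mA; have -> : normal_prob 0 (t * Num.sqrt (a k ^+ 2 + q)) A =
    normal_prob 0 (Num.sqrt ((a k * t) ^+ 2 + (t * Num.sqrt q) ^+ 2)) A.
  have -> : (a k * t) ^+ 2 + (t * Num.sqrt q) ^+ 2 = t ^+ 2 * (a k ^+ 2 + q).
    by rewrite !exprMn sqr_sqrtr ?ltW// mulrDr mulrC.
  rewrite -[LHS]normal_prob_abs; congr (normal_prob _ _ _).
  by rewrite sqrtrM ?sqr_ge0// sqrtr_sqr normrM (ger0_norm (sqrtr_ge0 _)).
apply: normal_rvD => //; rewrite ?mulf_neq0//.
- exact: measurable_funM.
- move=> B C mB mC.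
  pose f j := if j == k then Some true else if j \in s then Some false else
    None.
  pose F (c : bool) w := if c then a k * X k w else \sum_(j <- s) a j * X j w.
  apply: (@mutually_independent2 _ _ _ _ _ F true false) => //.
  apply: (mutually_independent_group (f := f) mX iX) => -[]/=.
    apply: measurable_funM => //; apply: measurable_fun_cylinders => /=.
    by rewrite /f eqxx.
  (* Only the variables with index in [s] are measurable for this block, whereas [measurable_sum]
     asks for every term; the conditional makes the other terms constant. *)
  rewrite [X in measurable_fun _ X](_ : _ = fun w =>
    \sum_(j <- s) (if j \in s then a j * X j w else 0)).
    apply: measurable_sum => j; have [js|js] := boolP (j \in s);
      last exact: measurable_cst.
    apply: measurable_funM => //; apply: measurable_fun_cylinders => /=.
    rewrite /f js; case: eqP => // jk.
    by rewrite -jk js in ks.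
  apply/funext => w; rewrite /F big_seq [RHS]big_seq; apply: eq_bigr => j ->//.
- exact: normal_rvZ.
- exact: IHs.
Qed.

End normal.

(** * Dithered quantization *)

Section dithering.
Context {R : realType}.
Notation mu := (@lebesgue_measure R).

Definition dither_error (sigma x v w : R) : R :=
  let D := 2 * sigma * Num.sqrt v in quantize D (x + D * w) - D * w - x.

(** The half step subtracted in [quantize] cancels the half added in [round_nearest]: for [D > 0],
    [y] goes to the midpoint of its cell between consecutive multiples of [D]. *)
Lemma quantizeE (D y : R) : D != 0 ->
  quantize D y = (Num.floor (y / D))%:~R * D + D / 2.
Proof.
move=> D0; rewrite /quantize /round_nearest; congr (_%:~R * _ + _).
by congr Num.floor; field.
Qed.

(** The step size factors out; what remains is one half minus the fractional part of [x / D + w]. *)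
Lemma dither_errorE (sigma x v w : R) : 0 < sigma -> 0 < v ->
  let D := 2 * sigma * Num.sqrt v in
  dither_error sigma x v w =
  D * ((Num.floor (x / D + w))%:~R + 2^-1 - w - x / D).
Proof.
move=> s0 v0 D; have D0 : D != 0.
  by rewrite mulf_neq0 ?gt_eqF// ?sqrtr_gt0// mulr_gt0.
rewrite /dither_error -/D quantizeE//.
have -> : (x + D * w) / D = x / D + w by field.
by field.
Qed.

Lemma measurable_floorR :
  measurable_fun setT (fun y : R => (Num.floor y)%:~R : R).
Proof.
by apply: nondecreasing_measurable => // y z yz; rewrite ler_int le_floor.
Qed.

Lemma measurable_dither_error {d} {U : measurableType d} (sigma : R)
    (X V W : U -> R) : 0 < sigma -> measurable_fun setT X ->
  measurable_fun setT V -> measurable_fun setT W ->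
  measurable_fun setT (fun u => dither_error sigma (X u) (V u) (W u)).
Proof.
move=> s0 mX mV mW.
have mD : measurable_fun setT (fun u => 2 * sigma * Num.sqrt (V u)).
  apply: measurable_funM => //; apply: measurableT_comp => //.
  by apply: continuous_measurable_fun; exact: sqrt_continuous.
have mDV : measurable_fun setT (fun u => (2 * sigma * Num.sqrt (V u))^-1).
  (* The inverse is measurable as the power with exponent -1. The two agree on nonnegative reals,
     including 0, the value of the step where [V u] is not positive. *)
  rewrite [X in measurable_fun _ X](_ : _ =
      fun u => (2 * sigma * Num.sqrt (V u)) `^ (-1)).
    exact: (measurableT_comp (measurable_powR (-1)) mD).
  by apply/funext => u; rewrite powR_inv1// mulr_ge0// mulr_ge0// ltW.
apply: measurable_funB => //; apply: measurable_funB;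
  last exact: measurable_funM.
apply: measurable_funD; last exact: measurable_funM.
apply: measurable_funM => //; apply: measurableT_comp measurable_floorR _.
apply: measurable_funD => //; apply: measurable_funM => //.
apply: measurable_funB; last exact: measurable_funM.
by apply: measurable_funD => //; exact: measurable_funM.
Qed.

(* On the unit interval [c + w] crosses exactly one integer [n]; the two pieces
   are reflected onto the two halves of ]-1/2, 1/2]. *)
Lemma integral_frac_uniform (c : R) (h : R -> \bar R) :
  measurable_fun setT h -> (forall x, 0 <= h x)%E ->
  (\int[mu]_w (h ((Num.floor (c + w))%:~R + 2^-1 - w - c)%R *
               (uniform_pdf (- (1 / 2)) (1 / 2) w)%:E) =
   \int[mu]_(u in `](- 2^-1)%R, (2^-1)%R[%classic) h u)%E.
Proof.
move=> mh h0.
(* [n] is the least integer above [c - 1/2], so the floor of [c + w] jumps at [w = t], a point of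
   ]-1/2, 1/2]. *)
pose n := Num.floor (c - 2^-1) + 1; pose t : R := n%:~R - c.
have t_gt : - 2^-1 < t.
  by have := floorD1_gt (c - 2^-1); rewrite -/n /t => ?; lra.
have t_le : t <= 2^-1.
  by have := floor_le (c - 2^-1); rewrite /t /n intrD => ?; lra.
pose k1 := h \_ `]- 2^-1, t]%classic; pose k2 := h \_ `]t, 2^-1]%classic.
have mk1 : measurable_fun setT k1 by apply: (iffLR (measurable_restrictT _ _))
  => //; apply: measurable_funTS.
have mk2 : measurable_fun setT k2 by apply: (iffLR (measurable_restrictT _ _))
  => //; apply: measurable_funTS.
have k10 u : (0 <= k1 u)%E by rewrite /k1 patchE; case: ifP.
have k20 u : (0 <= k2 u)%E by rewrite /k2 patchE; case: ifP.
pose H w := h ((Num.floor (c + w))%:~R + 2^-1 - w - c)%R.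
have mH : measurable_fun setT H.
  apply: measurableT_comp mh _; apply: measurable_funB => //.
  apply: measurable_funB => //; apply: measurable_funD => //.
  by apply: measurableT_comp measurable_floorR _; exact: measurable_funD.
transitivity (\int[mu]_(w in `[(- 2^-1)%R, (2^-1)%R]%classic) H w)%E.
  rewrite [RHS]integral_mkcond; apply: eq_integral => w _.
  rewrite patchE mem_setE in_itv/= /uniform_pdf !div1r.
  case: ifP => _; last by rewrite mule0.
  by rewrite opprK (_ : 2^-1 + 2^-1 = 1 :> R) ?invr1 ?mule1//; lra.
(* Without the right endpoint, a null set, the reflected pieces are exactly ]-1/2, t] and ]t, 1/2],
   with no overlap at [t]. *)
rewrite -integral_itv_bndo_bndc; last exact: measurable_funTS.
transitivity (\int[mu]_w (k1 (-1 * w + (t - 2^-1))%R +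
                          k2 (-1 * w + (t + 2^-1))%R))%E.
  rewrite integral_mkcond; apply: eq_integral => w _.
  rewrite /k1 /k2 !patchE !mem_setE !in_itv/= mulN1r.
  have [wt|tw] := ltP w t.
    have -> : (t < - w + (t + 2^-1) <= 2^-1) = false by apply/negbTE/negP; lra.
    have -> : (- 2^-1 < - w + (t - 2^-1) <= t) = (- 2^-1 <= w < 2^-1).
      by apply/idP/idP; lra.
    rewrite adde0; case: ifP => // /andP[w1 w2]; congr h.
    have -> : Num.floor (c + w) = n - 1.
      apply/floor_def; rewrite subrK intrD; move: wt t_le; rewrite /t => ? ?.
      by apply/andP; split; lra.
    by rewrite intrD /t; lra.
  have -> : (- 2^-1 < - w + (t - 2^-1) <= t) = false by apply/negbTE/negP; lra.
  have -> : (t < - w + (t + 2^-1) <= 2^-1) = (- 2^-1 <= w < 2^-1).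
    by apply/idP/idP; lra.
  rewrite add0e; case: ifP => // /andP[w1 w2]; congr h.
  have -> : Num.floor (c + w) = n.
    apply/floor_def; rewrite intrD; move: tw t_gt; rewrite /t => ? ?.
    by apply/andP; split; lra.
  by rewrite /t; lra.
have N10 : (-1 : R) != 0 by rewrite oppr_eq0 oner_neq0.
rewrite ge0_integralD//; last 2 first.
- by apply: measurableT_comp mk1 _; exact: measurable_affine.
- by apply: measurableT_comp mk2 _; exact: measurable_affine.
have := @ge0_integral_affine_neq0 _ (-1) (t - 2^-1) k1 N10 mk1 k10.
have := @ge0_integral_affine_neq0 _ (-1) (t + 2^-1) k2 N10 mk2 k20.
rewrite normrN1 !mul1e => <- <-.
rewrite -ge0_integralD//.
rewrite -(@integral_itv_bndoo _ _ _ h false false);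
  last exact: measurable_funTS.
rewrite [RHS]integral_mkcond; apply: eq_integral => u _.
rewrite /k1 /k2 !patchE !mem_setE !in_itv/=.
have [ut|tu] := leP u t.
  rewrite andbT adde0 (_ : _ && _ = (- 2^-1 < u))//.
  by apply/idP/idP; lra.
by rewrite andbF add0e (_ : - 2^-1 < u)//; lra.
Qed.

(** Translated by [q], the integrand is a multiple of the exponential density of rate 1/2. With
    [q = z ^+ 2 / sigma ^+ 2] the right-hand side is Gaussian in [z]. *)
Lemma integral_exp_tail (q K : R) : 0 <= K ->
  (\int[mu]_v (if q < v then K * expR (- (v / 2)) else 0)%:E =
   (2 * K * expR (- (q / 2)))%:E)%E.
Proof.
move=> K0.
have mE : measurable_fun setT (fun v : R => K * expR (- (v / 2))).
  apply: measurable_funM => //; apply: measurableT_comp => //.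
  by apply: measurableT_comp => //; exact: measurable_funM.
transitivity (\int[mu]_(v in `]q, +oo[%classic) (K * expR (- (v / 2)))%:E)%E.
  rewrite [RHS]integral_mkcond; apply: eq_integral => v _.
  by rewrite patchE mem_setE in_itv/= andbT; case: ifP.
rewrite integral_itv_obnd_cbnd; last exact/measurable_funTS/measurable_EFinP.
rewrite integral_mkcond (ge0_integral_shift q); last 2 first.
- apply: (iffLR (measurable_restrictT _ _)) => //.
  exact/measurable_funTS/measurable_EFinP.
- by move=> v; rewrite patchE; case: ifP => // _;
  rewrite lee_fin mulr_ge0 ?expR_ge0.
transitivity (\int[mu]_v ((2 * K * expR (- (q / 2)))%:E *
    (exponential_pdf (1 / 2) v)%:E))%E.
  apply: eq_integral => v _;
    rewrite /exponential_pdf !patchE !mem_setE !in_itv/= !andbT.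
  rewrite -lerBlDr subrr; case: ifP => _; last by rewrite mule0.
  rewrite -EFinM; congr EFin.
  have -> : - ((v + q) / 2) = - (q / 2) + - (1 / 2) * v by lra.
  by rewrite expRD; field.
have r0 : (0 < 1 / 2 :> R) by rewrite divr_gt0.
rewrite ge0_integralZl//.
- by rewrite integral_exponential_pdf// mule1.
- by apply/measurable_EFinP; exact: measurable_exponential_pdf.
- by move=> v _; rewrite lee_fin exponential_pdf_ge0// ltW.
- by rewrite lee_fin !mulr_ge0 ?expR_ge0.
Qed.

Lemma Gamma_fn_ge0 (k : R) : 0 <= Gamma_fn k.
Proof.
rewrite fine_ge0//; apply: integral_ge0 => t _.
by rewrite lee_fin mulr_ge0 ?powR_ge0 ?expR_ge0.
Qed.

Lemma gamma_pdf_ge0 (k theta x : R) : 0 <= gamma_pdf k theta x.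
Proof.
rewrite /gamma_pdf; case: ifP => // _; rewrite !mulr_ge0 ?powR_ge0 ?expR_ge0//.
by rewrite invr_ge0 Gamma_fn_ge0.
Qed.

Lemma measurable_gamma_pdf (k theta : R) :
  measurable_fun setT (gamma_pdf k theta).
Proof.
apply: measurable_fun_ifT => //; first exact: measurable_fun_ltr.
apply: measurable_funM.
  by apply: measurable_funM => //; exact: measurable_powR.
by apply: measurableT_comp => //; apply: measurableT_comp.
Qed.

Section dither_normal.
Context {d : measure_display} {T : measurableType d}.
Variables (P : probability T R) (V W : T -> R) (sigma x : R).
Hypothesis sigma_gt0 : 0 < sigma.
Hypotheses (mV : measurable_fun setT V) (mW : measurable_fun setT W).
Hypothesis iVW : forall A B : set R, measurable A -> measurable B ->
  P (V @^-1` A `&` W @^-1` B) = (P (V @^-1` A) * P (W @^-1` B))%E.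
Hypothesis gV : forall A : set R, measurable A ->
  P (V @^-1` A) = gamma_prob (3 / 2) (1 / 2) A.
Hypothesis uW : forall A : set R, measurable A ->
  P (W @^-1` A) = unif_prob (- (1 / 2)) (1 / 2) A.

Let c0 : R := (1 / 2) `^ (3 / 2) / Gamma_fn (3 / 2).

Let c0_ge0 : 0 <= c0.
Proof. by rewrite mulr_ge0 ?powR_ge0// invr_ge0 Gamma_fn_ge0. Qed.

Let gammaE v : 0 < v ->
  gamma_pdf (3 / 2) (1 / 2) v = c0 * Num.sqrt v * expR (- (v / 2)).
Proof.
move=> v0; rewrite /gamma_pdf v0 -/c0 (_ : 3 / 2 - 1 = 2^-1); last by lra.
by rewrite powR12_sqrt ?ltW//; congr (_ * expR _); lra.
Qed.

(** Joint density of the error [z] and of [v]: the uniform density [1 / (2 sigma sqrt v)] on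
    [|z| < sigma sqrt v] times the gamma density. The factor [sqrt v] coming from the shape 3/2
    cancels the one in the denominator, and a pure exponential in [v] is left. *)
Let q (z v : R) : R :=
  if z ^+ 2 / sigma ^+ 2 < v then c0 / (2 * sigma) * expR (- (v / 2)) else 0.

Let K_ge0 : 0 <= c0 / (2 * sigma).
Proof. by rewrite divr_ge0// mulr_ge0// ltW. Qed.

Let q_ge0 z v : 0 <= q z v.
Proof. by rewrite /q; case: ifP => // _; rewrite mulr_ge0 ?expR_ge0. Qed.

Let mq : measurable_fun setT (fun z : R * R => q z.2 z.1).
Proof.
apply: measurable_fun_ifT => //.
  apply: measurable_fun_ltr => //; apply: measurable_funM => //.
  exact: measurable_funX.
apply: measurable_funM => //; apply: measurableT_comp => //.
by apply: measurableT_comp => //; exact: measurable_funM.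
Qed.

Let inner (A : set R) (v : R) : measurable A ->
  (\int[mu]_w ((\1_A (dither_error sigma x v w))%:E *
     (uniform_pdf (- (1 / 2)) (1 / 2) w)%:E * (gamma_pdf (3 / 2) (1 / 2)
       v)%:E) =
   \int[mu]_z ((\1_A z)%:E * (q z v)%:E))%E.
Proof.
move=> mA; have mA1 : measurable_fun setT (fun y : R => (\1_A y)%:E : \bar R).
  exact/measurable_EFinP.
have [v0|v0] := ltP 0 v; last first.
  rewrite !integral0_eq// => z _.
    rewrite /q ltNge (le_trans v0) ?mule0//.
    by rewrite divr_ge0 ?sqr_ge0.
  by rewrite /gamma_pdf ltNge v0/= mule0.
have sv0 : 0 < Num.sqrt v by rewrite sqrtr_gt0.
pose D := 2 * sigma * Num.sqrt v.
have D0 : 0 < D by rewrite !mulr_gt0.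
have mDu : measurable_fun setT (fun u : R => (\1_A (D * u))%:E : \bar R).
  by apply: (measurableT_comp mA1); exact: measurable_funM.
have g0 := gamma_pdf_ge0 (3 / 2) (1 / 2) v.
rewrite ge0_integralZr//; last 2 first.
- apply: emeasurable_funM.
    apply: (measurableT_comp mA1).
    exact: (@measurable_dither_error _ R sigma (cst x) (cst v) id).
  by apply/measurable_EFinP; exact: measurable_uniform_pdf.
- move=> w _; rewrite mule_ge0// lee_fin uniform_pdf_ge0//.
  by rewrite gtrN// divr_gt0.
under eq_integral do rewrite dither_errorE//.
rewrite (@integral_frac_uniform (x / D) (fun u => (\1_A (D * u))%:E))//.
pose k z : \bar R := ((\1_A z)%:E * (\1_(`](- (sigma * Num.sqrt v))%R,
  (sigma * Num.sqrt v)%R[%classic) z)%:E)%E.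
have mk : measurable_fun setT k.
  by apply: emeasurable_funM => //; exact/measurable_EFinP/measurable_indic.
have k0 z : (0 <= k z)%E by rewrite mule_ge0 ?lee_fin.
have -> : (\int[mu]_(u in `](- 2^-1)%R, (2^-1)%R[%classic) (\1_A (D * u))%:E =
    D^-1%:E * \int[mu]_z k z)%E.
  rewrite (@ge0_integral_affine _ D 0 k)// muleA -EFinM mulVf ?gt_eqF// mul1e.
  rewrite integral_mkcond; apply: eq_integral => u _.
  rewrite patchE mem_setE in_itv/= /k addr0 [\1_`]_,
    _[%classic _]indicE mem_setE in_itv/=.
  have -> : (- (sigma * Num.sqrt v) < D * u < sigma * Num.sqrt v)
    = (- 2^-1 < u < 2^-1).
    have -> : sigma * Num.sqrt v = D * 2^-1 by rewrite /D; field.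
    by rewrite -mulrN !ltr_pM2l.
  by case: ifP; rewrite ?mule1 ?mule0.
rewrite muleAC -EFinM -ge0_integralZl//;
  last by rewrite lee_fin mulr_ge0// invr_ge0 ltW.
apply: eq_integral => z _; rewrite /k muleCA; congr (_ * _)%E.
rewrite -EFinM; congr EFin; rewrite indicE mem_setE in_itv/= /q.
have -> : (z ^+ 2 / sigma ^+ 2 < v) = (- (sigma * Num.sqrt v)
  < z < sigma * Num.sqrt v).
  rewrite ltr_pdivrMr ?exprn_gt0// -ltr_norml -[LHS]ltr_sqrt; last first.
    by rewrite mulr_gt0// exprn_gt0.
  rewrite sqrtr_sqr sqrtrM ?ltW// sqrtr_sqr.
  by rewrite (gtr0_norm sigma_gt0) [sigma * _]mulrC.
case: ifP => _; last by rewrite mulr0.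
rewrite mulr1 gammaE// /D; field.
by rewrite !gt_eqF.
Qed.

(** Exchanging the integrals puts [v] innermost; at fixed [z] it ranges over a half-line starting at
    [z ^+ 2 / sigma ^+ 2], and the exponential tail there is the Gaussian profile. *)
Let error_density (A : set R) : measurable A ->
  (P ((fun w => dither_error sigma x (V w) (W w)) @^-1` A) =
   \int[mu]_z ((\1_A z)%:E * (c0 / sigma * normal_fun 0 sigma z)%:E))%E.
Proof.
move=> mA; have mA1 : measurable_fun setT (fun y : R => (\1_A y)%:E : \bar R).
  exact/measurable_EFinP.
rewrite probability_integral_indic//; last exact: measurable_dither_error.
pose h (z : R * R) : \bar R := (\1_A (dither_error sigma x z.1 z.2))%:E.
have -> : (\int[P]_w (\1_A (dither_error sigma x (V w) (W w)))%:E =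
    \int[P]_w h (V w, W w))%E by [].
rewrite (@ge0_integral_independent_density _ _ _ P V W mV mW iVW
  (gamma_pdf (3 / 2) (1 / 2)) (uniform_pdf (- (1 / 2)) (1 / 2)))//;
    last 6 first.
- exact: measurable_gamma_pdf.
- exact: gamma_pdf_ge0.
- exact: measurable_uniform_pdf.
- by move=> y; rewrite uniform_pdf_ge0// gtrN// divr_gt0.
- by apply: (measurableT_comp mA1); exact: measurable_dither_error.
- by move=> z; rewrite lee_fin.
under eq_integral do rewrite /h/= inner//.
rewrite (@fubini_tonelli _ _ _ _ _ mu mu
  (fun z : R * R => (\1_A z.2)%:E * (q z.2 z.1)%:E)%E)/=; last 2 first.
- apply: emeasurable_funM; first exact: (measurableT_comp mA1).
  exact/measurable_EFinP.
- by move=> z; rewrite mule_ge0// lee_fin.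
apply: eq_integral => z _; rewrite ge0_integralZl//; last 2 first.
- apply/measurable_EFinP.
  have mvz : measurable_fun setT (fun v : R =>
    (v, z)) by exact: measurable_fun_pair.
  exact: (measurableT_comp mq mvz).
- by move=> v _; rewrite lee_fin.
congr (_ * _)%E; rewrite integral_exp_tail//; congr EFin.
rewrite /normal_fun subr0 (_ : 2 * (c0 / (2 * sigma)) = c0 / sigma).
  by congr (_ * expR _); field; rewrite gt_eqF.
by field; rewrite gt_eqF.
Qed.

(* Taking [A = setT] identifies the constant, so that [Gamma_fn (3 / 2)] never
   has to be computed. *)
Lemma dither_error_normal :
  normal_rv P (fun w => dither_error sigma x (V w) (W w)) sigma.
Proof.
have s0 : sigma != 0 by rewrite gt_eqF.
pose K := c0 / sigma / normal_peak sigma.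
have K0 : 0 <= K.
  by rewrite divr_ge0 ?normal_peak_ge0// divr_ge0 ?(ltW sigma_gt0).
have dE z : c0 / sigma * normal_fun 0 sigma z = K * normal_pdf 0 sigma z.
  by rewrite normal_pdfE// mulrA divfK// gt_eqF// normal_peak_gt0.
have mp : measurable_fun setT (fun z : R => (normal_pdf 0 sigma z)%:E).
  by apply/measurable_EFinP; exact: measurable_normal_pdf.
have PE A : measurable A ->
    (P ((fun w => dither_error sigma x (V w) (W w)) @^-1` A) =
     K%:E * normal_prob 0 sigma A)%E.
  move=> mA; rewrite error_density// /normal_prob [in RHS]integral_indicM.
  rewrite -ge0_integralZl//.
  - by apply: eq_integral => z _; rewrite dE EFinM muleCA.
  - by apply: emeasurable_funM => //; exact/measurable_EFinP.
  - by move=> z _; rewrite mule_ge0// lee_fin normal_pdf_ge0.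
have K1 : K = 1.
  have := PE _ measurableT; rewrite preimage_setT probability_setT.
  by rewrite [normal_prob _ _ _]probability_setT mule1 => -[].
by move=> A mA; rewrite PE// K1 mul1e.
Qed.

End dither_normal.

End dithering.

(** * Likelihood ratios and laws of vectors *)

Section measures.
Context {R : realType}.

(** Turns an integral over a varying set into a measure, the form needed by [vec_measure_unique]. *)
Lemma density_measure_exists {d} {T : measurableType d}
    (mu : {measure set T -> \bar R}) (f : T -> \bar R) :
  measurable_fun setT f -> (forall x, 0 <= f x)%E ->
  exists nu : {measure set T -> \bar R},
    forall A, nu A = (\int[mu]_(x in A) f x)%E.
Proof.
move=> mf f0; pose nu0 A := (\int[mu]_(x in A) f x)%E.
have nu00 : nu0 set0 = 0%E by rewrite /nu0 integral_set0.
have nu0_ge0 A : (0 <= nu0 A)%E by exact: integral_ge0.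
have nu0_sigma : semi_sigma_additive nu0.
  move=> F mF tF mUF; rewrite /nu0 ge0_integral_bigcup//; last first.
    exact: measurable_funTS.
  apply: is_cvg_ereal_nneg_natsum_cond => n _ _; exact: integral_ge0.
pose nu : {measure set T -> \bar R} :=
  HB.pack nu0 (isMeasure.Build _ _ _ nu0 nu00 nu0_ge0 nu0_sigma).
by exists nu.
Qed.

Lemma pushforward_measure_exists {d d'} {T : measurableType d}
    {T' : measurableType d'} (mu : {measure set T -> \bar R}) (f : T -> T') :
  measurable_fun setT f ->
  exists nu : {measure set T' -> \bar R}, forall A, nu A = mu (f @^-1` A).
Proof.
move=> mf; unshelve refine (ex_intro _
  (pushforward mu f : {measure set T' -> \bar R}) _); first exact: mf.
by [].
Qed.

(* Pointwise, [1_E f1 + a 1_G f0 <= a 1_E f0 + 1_G f1]. *)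
Lemma neyman_pearson {d} {T : measurableType d}
    (mu : {measure set T -> \bar R}) (f0 f1 : T -> R) (a : R) (E G : set T) :
  measurable_fun setT f0 -> measurable_fun setT f1 ->
  (forall x, 0 <= f0 x) -> (forall x, 0 <= f1 x) -> 0 <= a ->
  measurable E -> measurable G ->
  (forall x, G x -> a * f0 x <= f1 x) ->
  (forall x, ~ G x -> f1 x <= a * f0 x) ->
  (\int[mu]_(x in E) (f1 x)%:E + a%:E * \int[mu]_(x in G) (f0 x)%:E <=
   a%:E * \int[mu]_(x in E) (f0 x)%:E + \int[mu]_(x in G) (f1 x)%:E)%E.
Proof.
move=> mf0 mf1 f00 f10 a0 mE mG hG hNG.
have mi (A : set T) (f : T -> R) : measurable A -> measurable_fun setT f ->
    measurable_fun setT (fun x => (\1_A x)%:E * (f x)%:E : \bar R)%E.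
  by move=> mA mf; apply: emeasurable_funM; exact/measurable_EFinP.
have i0 (A : set T) (f : T -> R) x : (forall x, 0 <= f x) ->
    (0 <= (\1_A x)%:E * (f x)%:E :> \bar R)%E.
  by move=> f_ge0; rewrite mule_ge0// lee_fin.
rewrite (integral_indicM _ E (fun x => (f1 x)%:E)).
rewrite (integral_indicM _ G (fun x => (f0 x)%:E)).
rewrite (integral_indicM _ E (fun x => (f0 x)%:E)).
rewrite (integral_indicM _ G (fun x => (f1 x)%:E)).
have a0' : (0 <= a%:E)%E by rewrite lee_fin.
rewrite -!ge0_integralZl//; try exact: mi; try by move=> x _; exact: i0.
rewrite -!ge0_integralD//; try (by move=> x _; apply: i0);
  try (by move=> x _; apply: mule_ge0 => //; apply: i0);
  try (by apply: measurable_funeM; exact: mi); try exact: mi.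
apply: ge0_le_integral => //.
- move=> x _; apply: adde_ge0; first exact: i0.
  by apply: mule_ge0 => //; exact: i0.
- by apply: emeasurable_funD; [exact: mi|apply: measurable_funeM; exact: mi].
- by apply: emeasurable_funD; [apply: measurable_funeM; exact: mi|exact: mi].
- move=> x _; rewrite !indicE -!EFinM -!EFinD lee_fin.
  have [/set_mem Gx|/negP xG] := boolP (x \in G); rewrite ?mul1r ?mul0r ?mulr0.
    by have := hG _ Gx; case: (x \in E); rewrite ?mul1r ?mul0r ?mulr0; lra.
  have := hNG x (fun Gx => xG (mem_set Gx)).
  by case: (x \in E); rewrite ?mul1r ?mul0r ?mulr0; lra.
Qed.

End measures.

Section vectors.
Context {R : realType}.
Variable m : nat.
Notation vec := (g_sigma_algebraType (@rect_sets R m)).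

Lemma measurable_vec_coord (j : 'I_m) :
  measurable_fun setT (fun z : vec => z j).
Proof.
move=> _ A mA; rewrite setTI; apply: sub_sigma_algebra.
exists (fun i => if i == j then A else setT); split; first by move=> i;
  case: ifP.
apply/seteqP; split => [z Az i _|z /(_ j Logic.I)] /=; last by rewrite eqxx.
by case: eqP => [->//|].
Qed.

Lemma measurable_fun_vec {d} {T : measurableType d} (X : 'I_m -> T -> R) :
  (forall j, measurable_fun setT (X j)) ->
  measurable_fun setT ((fun w j => X j w) : T -> vec).
Proof.
move=> mX; apply: (@measurability _ _ T vec setT _ (@rect_sets R m)) => //.
move=> _ [_ [A [mA ->]] <-]; rewrite setTI preimage_bigcap.
apply: fin_bigcap_measurable => // j _.
by have := mX j measurableT _ (mA j); rewrite setTI.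
Qed.

Lemma vec_measurable_preimage {d} {T : measurableType d} (X : 'I_m -> T -> R)
    (O : set ('I_m -> R)) :
  (forall j, measurable_fun setT (X j)) -> vec_measurable O ->
  measurable [set w | O (fun j => X j w)].
Proof.
move=> mX mO; have := measurable_fun_vec mX measurableT mO.
by rewrite setTI.
Qed.

Lemma vec_measurable_shift (c : 'I_m -> R) (O : set ('I_m -> R)) :
  vec_measurable O -> vec_measurable [set z | O (fun j => z j + c j)].
Proof.
move=> mO.
apply: (@vec_measurable_preimage _ vec (fun j z => z j + c j) O) => // j.
by apply: measurable_funD => //; exact: measurable_vec_coord.
Qed.

(** Rectangles form a π-system that contains the whole space, where [m1] is finite. *)
Lemma vec_measure_unique (m1 m2 : {measure set vec -> \bar R}) :
  (m1 setT < +oo)%E ->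
  (forall A : 'I_m -> set R, (forall j, measurable (A j)) ->
    m1 (\bigcap_j ((fun x : 'I_m -> R => x j) @^-1` A j)) =
    m2 (\bigcap_j ((fun x : 'I_m -> R => x j) @^-1` A j))) ->
  forall O, vec_measurable O -> m1 O = m2 O.
Proof.
move=> fin m12 O mO.
apply: (@g_sigma_algebra_measure_unique _ _ vec (@rect_sets R m) _ (fun=>
  setT)) => //.
- by move=> A GA; exact: sub_sigma_algebra.
- move=> _; exists (fun=> setT); split => //.
  by apply/esym; rewrite -subTset => x _ j _.
- by rewrite bigcup_const.
- move=> _ _ [A [mA ->]] [B [mB ->]]; exists (fun j => A j `&` B j); split.
    by move=> j; exact: measurableI.
  apply/seteqP; split=> [x [Ax Bx] k _|x ABx]; first by split;
    [exact: Ax|exact: Bx].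
  by split=> k _; have [] := ABx k Logic.I.
- by move=> _ [A [mA ->]]; exact: m12.
Qed.

End vectors.

(** * Cameron-Martin formula *)

Section cameron_martin.
Context {R : realType} {d : measure_display} {T : measurableType d}.
Variable P : probability T R.
Notation mu := (@lebesgue_measure R).

Lemma ge0_expectation_prod (K : finType) (X : K -> T -> R) (f : K -> R -> R)
    (s : seq K) : uniq s ->
  (forall k, measurable_fun setT (X k)) -> mutually_independent P X ->
  (forall k, measurable_fun setT (f k)) -> (forall k x, 0 <= f k x) ->
  (\int[P]_w (\prod_(k <- s) f k (X k w))%:E =
   \prod_(k <- s) \int[P]_w (f k (X k w))%:E)%E.
Proof.
move=> + mX iX mf f0; elim: s => [_|k s IHs /= /andP[ks us]].
  rewrite big_nil; under eq_integral do rewrite big_nil.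
  by rewrite integral_cst//= mul1e probability_setT.
under eq_integral do rewrite big_cons.
rewrite big_cons -IHs//.
pose g j := if j == k then Some true else if j \in s then Some false else None.
pose F (c : bool) w := if c then f k (X k w) else \prod_(j <- s) f j (X j w).
have mprod d' (U : measurableType d') (Y : K -> U -> R) :
    (forall j, j \in s -> measurable_fun setT (Y j)) ->
    measurable_fun setT (fun w => \prod_(j <- s) Y j w).
  move=> mY; rewrite [X in measurable_fun _ X](_ : _ =
      fun w => \prod_(j <- s) (if j \in s then Y j w else 1)).
    apply: measurable_prod => j; have [js|js] := boolP (j \in s).
      by move=> _; exact: mY.
    by move=> _; exact: measurable_cst.
  by apply/funext => w; rewrite big_seq [RHS]big_seq; apply: eq_bigr => j ->.
rewrite ge0_expectation_independentM//.
- exact: measurableT_comp.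
- by apply: mprod => j _; exact: measurableT_comp.
- move=> B C mB mC.
  apply: (@mutually_independent2 _ _ _ _ _ F true false) => //.
  apply: (mutually_independent_group (f := g) mX iX) => -[]/=.
    apply: measurableT_comp => //; apply: measurable_fun_cylinders => /=.
    by rewrite /g eqxx.
  apply: mprod => j js; apply: measurableT_comp => //.
  apply: measurable_fun_cylinders; rewrite /= /g js; case: eqP => // jk.
  by rewrite -jk js in ks.
- by move=> w; apply: prodr_ge0.
Qed.

(** The terms quadratic in [x] cancel, so the log-likelihood ratio of two translates is affine in
    [x]. *)
Lemma normal_pdf_ratio (s u x : R) : s != 0 ->
  normal_pdf u s x = expR ((u * x - u ^+ 2 / 2) / s ^+ 2) * normal_pdf 0 s x.
Proof.
move=> s0; rewrite !normal_pdfE// mulrCA /normal_fun -expRD.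
by congr (_ * expR _); field.
Qed.

Lemma measurable_exp_tilt (s u : R) :
  measurable_fun setT (fun x : R => expR ((u * x - u ^+ 2 / 2) / s ^+ 2)).
Proof.
apply: measurableT_comp => //.
rewrite [X in measurable_fun _ X](_ : _ =
    fun x => u / s ^+ 2 * x + - (u ^+ 2 / 2 / s ^+ 2)).
  exact: measurable_affine.
by apply/funext => x; rewrite mulrBl mulrAC.
Qed.

Lemma normal_rv_tilt (X : T -> R) (s u : R) (A : set R) : s != 0 ->
  measurable_fun setT X -> normal_rv P X s -> measurable A ->
  (\int[P]_w (\1_A (X w) * expR ((u * X w - u ^+ 2 / 2) / s ^+ 2))%:E =
   P ((fun w => (X w + u)%R) @^-1` A))%E.
Proof.
move=> s0 mX nX mA.
have mt : measurable_fun setT (fun x : R =>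
    (\1_A x * expR ((u * x - u ^+ 2 / 2) / s ^+ 2))%:E).
  by apply/measurable_EFinP/measurable_funM => //; exact: measurable_exp_tilt.
have t0 (x : R) : (0 <= (\1_A x * expR ((u * x - u ^+ 2 / 2) / s ^+ 2))%:E)%E.
  by rewrite lee_fin mulr_ge0 ?expR_ge0.
pose T1 := measurableTypeR R.
pose X' : {RV P >-> T1} := HB.pack X (isMeasurableFun.Build _ _ _ T1 _ mX).
transitivity (\int[distribution P X']_x
    (\1_A x * expR ((u * x - u ^+ 2 / 2) / s ^+ 2))%:E)%E.
  by rewrite ge0_integral_distribution.
rewrite (@ge0_integral_density _ _ _ mu _ (normal_pdf 0 s))//; last 2 first.
- exact: measurable_normal_pdf.
- exact: normal_pdf_ge0.
transitivity (normal_prob u s A).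
  rewrite /normal_prob [RHS]integral_indicM; apply: eq_integral => x _.
  by rewrite (normal_pdf_ratio u)// -!EFinM mulrA.
have -> : (fun w => X w + u) @^-1` A = X @^-1` ((fun x => 1 * x + u) @^-1` A).
  by apply/seteqP; split => w /=; rewrite mul1r.
rewrite nX.
  have := normal_prob_affine u (oner_neq0 R) s0 mA.
  by rewrite [1 * s]mul1r.
by rewrite -[X in measurable X]setTI; exact: measurable_affine.
Qed.

Variables (m : nat) (Z : 'I_m -> T -> R) (s : R).
Hypothesis s_gt0 : 0 < s.
Hypothesis mZ : forall j, measurable_fun setT (Z j).
Hypothesis iZ : mutually_independent P Z.
Hypothesis nZ : forall j, normal_rv P (Z j) s.

Let s0 : s != 0. Proof. by rewrite gt_eqF. Qed.

(** The likelihood ratio of [Z + u] to [Z], evaluated at [Z]: a product of the one-dimensional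
    ratios of [normal_pdf_ratio]. *)
Definition tilt (u : 'I_m -> R) (w : T) : R :=
  \prod_(j < m) expR ((u j * Z j w - u j ^+ 2 / 2) / s ^+ 2).

Lemma tilt_ge0 u w : 0 <= tilt u w.
Proof. by apply: prodr_ge0 => j _; exact: expR_ge0. Qed.

Lemma measurable_tilt u : measurable_fun setT (tilt u).
Proof.
apply: measurable_prod => j _.
exact: (measurableT_comp (measurable_exp_tilt s (u j)) (mZ j)).
Qed.

(** Both sides are measures in [O]. On rectangles they factor over the coordinates by independence,
    and each factor is an instance of [normal_rv_tilt]. *)
Lemma cameron_martin (u : 'I_m -> R) (O : set ('I_m -> R)) :
  vec_measurable O ->
  P [set w | O (fun j => Z j w + u j)] =
  (\int[P]_(w in [set w | O (fun j => Z j w)]) (tilt u w)%:E)%E.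
Proof.
move=> mO.
have mZu : measurable_fun setT
    ((fun w j => Z j w + u j) : T -> g_sigma_algebraType (@rect_sets R m)).
  by apply: (measurable_fun_vec (X := fun j w => Z j w + u j)) => j;
    exact: measurable_funD.
have mZv := measurable_fun_vec mZ.
have [nu nuE] : exists nu : {measure set T -> \bar R},
    forall A, nu A = (\int[P]_(w in A) (tilt u w)%:E)%E.
  apply: density_measure_exists; last by move=> w; rewrite lee_fin tilt_ge0.
  by apply/measurable_EFinP; exact: measurable_tilt.
have [m1 m1E] := pushforward_measure_exists P mZu.
have [m2 m2E] := pushforward_measure_exists nu mZv.
have <- : m1 O = P [set w | O (fun j => Z j w + u j)] by rewrite m1E.
have -> : (\int[P]_(w in [set w | O (fun j => Z j w)]) (tilt u w)%:E)%E = m2 O.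
  by rewrite m2E nuE.
apply: vec_measure_unique mO => [|A mA].
  have -> : m1 setT = 1%E by rewrite m1E; exact: probability_setT.
  exact: ltry.
rewrite m1E m2E nuE.
pose Zu j w := Z j w + u j.
have iZu : mutually_independent P Zu.
  apply: (mutually_independent_group (f := Some) mZ iZ) => j.
  by apply: measurable_funD => //; exact: measurable_fun_cylinders.
rewrite preimage_bigcap.
transitivity (P (\bigcap_j (Zu j @^-1` A j))); first by [].
rewrite iZu//.
transitivity (\prod_(j < m) \int[P]_w
    (\1_(A j) (Z j w) * expR ((u j * Z j w - u j ^+ 2 / 2) / s ^+ 2))%:E)%E.
  by apply: eq_bigr => j _; rewrite normal_rv_tilt.
pose f j x := \1_(A j) x * expR ((u j * x - u j ^+ 2 / 2) / s ^+ 2).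
rewrite -(@ge0_expectation_prod _ Z f) ?index_enum_uniq//; last 2 first.
- by move=> j; apply: measurable_funM => //; exact: measurable_exp_tilt.
- by move=> j x; rewrite mulr_ge0 ?expR_ge0.
rewrite [RHS]integral_indicM; apply: eq_integral => w _.
rewrite /f big_split/= EFinM; congr (_ * _)%E; congr EFin.
rewrite !indicE; have [/set_mem Aw|Aw] := boolP (w \in _).
  by rewrite big1// => j _; rewrite indicE mem_set//; exact: (Aw j Logic.I).
apply/eqP; rewrite prodf_seq_eq0; apply/hasP.
have /existsNP[j] : ~ (forall j, A j (Z j w)).
  by move=> H; move/negP : Aw; apply; rewrite inE => j _; exact: H.
move=> NA; exists j; rewrite ?mem_index_enum//= indicE memNset//.
Qed.

End cameron_martin.

(** * Gaussian mechanism *)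

Section gaussian_mechanism.
Context {R : realType}.
Notation mu := (@lebesgue_measure R).

Lemma normal_prob_fin (a s : R) (A : set R) : measurable A ->
  normal_prob a s A = (fine (normal_prob a s A))%:E.
Proof. by move=> mA; rewrite fineK//; apply: fin_num_measure. Qed.

Lemma normal_prob_tail (c : R) :
  normal_prob 0 1 `]c, +oo[%classic = (Phi (- c))%:E.
Proof.
rewrite /Phi -normal_prob_fin//.
have -> : `]c, +oo[%classic = (fun x : R =>
  -1 * x + 0) @^-1` `]-oo, (- c)[%classic.
  by apply/seteqP; split => x /=; rewrite !in_itv/= ?andbT; lra.
have N10 : (-1 : R) != 0 by rewrite oppr_eq0 oner_neq0.
rewrite (normal_prob_affine 0 N10 (oner_neq0 R) (measurable_itv _)).
(* Reflection yields an open half-line while [Phi] is defined on a closed one; the endpoint has mass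
   zero. *)
rewrite -normal_prob_abs mulr1 normrN1 /normal_prob integral_itv_bndo_bndc//.
by apply/measurable_funTS/measurable_EFinP; exact: measurable_normal_pdf.
Qed.

Lemma normal_prob_shift_tail (D c : R) :
  normal_prob D 1 `]c, +oo[%classic = (Phi (D - c))%:E.
Proof.
have := normal_prob_affine D (oner_neq0 R) (oner_neq0 R)
  (measurable_itv `]c, +oo[).
rewrite mulr1 => <-; rewrite -[D - c]opprB -normal_prob_tail.
congr normal_prob; apply/seteqP; split => x /=; rewrite !in_itv/= ?andbT; lra.
Qed.

(* The hockey-stick divergence of N(D, 1) from N(0, 1) at [expR eps], attained on
   the half-line ]eps / D + D / 2, +oo[. *)
Definition gauss_delta (eps D : R) : R :=
  Phi (D / 2 - eps / D) - expR eps * Phi (- (D / 2) - eps / D).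

Lemma le_gauss_delta (eps D : R) (A : set R) : 0 < D -> measurable A ->
  (normal_prob D 1 A <= (expR eps)%:E * normal_prob 0 1 A +
                        (gauss_delta eps D)%:E)%E.
Proof.
(* At [c] the likelihood ratio [expR (D * x - D ^+ 2 / 2)] equals [expR eps]. *)
move=> D0 mA; pose c := eps / D + D / 2.
have mp m' : measurable_fun setT (@normal_pdf R m' 1)
  by exact: measurable_normal_pdf.
have rE x : normal_pdf D 1 x = expR (D * x - D ^+ 2 / 2) * normal_pdf 0 1 x.
  by rewrite (@normal_pdf_ratio _ 1 D) ?oner_neq0// expr1n divr1.
have Dc : D * c = eps + D ^+ 2 / 2 by rewrite /c; field; rewrite gt_eqF.
have := @neyman_pearson _ _ _ mu (normal_pdf 0 1) (normal_pdf D 1) (expR eps)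
  A `]c, +oo[%classic (mp 0) (mp D) (@normal_pdf_ge0 _ 0 1)
  (@normal_pdf_ge0 _ D 1) (expR_ge0 _) mA (measurable_itv _).
rewrite -/(normal_prob 0 1 A) -/(normal_prob D 1 A).
rewrite -/(normal_prob 0 1 `]c, +oo[%classic) -/(normal_prob D 1 `]c,
  +oo[%classic).
rewrite normal_prob_tail normal_prob_shift_tail (normal_prob_fin 0)//
  (normal_prob_fin D)//.
rewrite -!EFinM -!EFinD !lee_fin /gauss_delta.
have -> : D - c = D / 2 - eps / D by rewrite /c; lra.
have -> : - c = - (D / 2) - eps / D by rewrite /c; lra.
move=> H; rewrite addrA lerBrDr; apply: H => x /=.
  rewrite in_itv/= andbT rE => cx; apply: ler_wpM2r;
    first exact: normal_pdf_ge0.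
  rewrite ler_expR lerBrDr -Dc ler_pM2l//; exact: ltW.
rewrite in_itv/= andbT rE => /negP; rewrite -leNgt => cx.
apply: ler_wpM2r; first exact: normal_pdf_ge0.
by rewrite ler_expR lerBlDr -Dc ler_pM2l.
Qed.

Lemma gauss_delta_ge0 (eps D : R) : 0 < D -> 0 <= gauss_delta eps D.
Proof.
move=> D0; have := @le_gauss_delta eps D set0 D0 measurable0.
by rewrite !measure0 mule0 add0e lee_fin.
Qed.

Context {d : measure_display} {T : measurableType d}.
Variables (P : probability T R) (m : nat) (Z : 'I_m -> T -> R) (s : R).
Hypothesis s_gt0 : 0 < s.
Hypothesis mZ : forall j, measurable_fun setT (Z j).
Hypothesis iZ : mutually_independent P Z.
Hypothesis nZ : forall j, normal_rv P (Z j) s.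

(* The optimal test between the two laws is the half-space orthogonal to [u],
   on which everything reduces to the law of [\sum_j u j * Z j]. *)
Lemma gaussian_shift (eps D : R) (u : 'I_m -> R) (O : set ('I_m -> R)) :
  0 <= eps -> 0 < D -> \sum_(j < m) u j ^+ 2 <= (D * s) ^+ 2 ->
  vec_measurable O ->
  (P [set w | O (fun j => (Z j w + u j)%R)] <=
   (expR eps)%:E * P [set w | O (fun j => Z j w)] + (gauss_delta eps D)%:E)%E.
Proof.
move=> eps0 D0 uD mO.
have mOZ : measurable [set w | O (fun j =>
  Z j w)] by exact: vec_measurable_preimage.
have e1 : 1 <= expR eps by rewrite -expR0 ler_expR.
set q := \sum_(j < m) u j ^+ 2 in uD.
have : 0 <= q by apply: sumr_ge0 => j _; exact: sqr_ge0.
(* If [u] vanishes, the linear form is zero and has no normal law; the bound is then clear from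
   [1 <= expR eps] and [gauss_delta_ge0]. *)
rewrite le_eqVlt => /predU1P[q0|q0].
  have u0 j : u j = 0.
    have /eqP := esym q0; rewrite /q psumr_eq0; last by move=> i _;
      exact: sqr_ge0.
    by move=> /allP/(_ j); rewrite mem_index_enum sqrf_eq0 => /(_ isT)/eqP.
  have -> : [set w | O (fun j => Z j w + u j)] = [set w | O (fun j => Z j w)].
    apply/seteqP; split => w /=;
      by rewrite (_ : (fun j => Z j w + u j) = (fun j => Z j w))//;
        apply/funext => j; rewrite u0 addr0.
  have pE : P [set w | O (fun j => Z j w)] = (fine (P [set w | O (fun j =>
    Z j w)]))%:E.
    by rewrite fineK// fin_num_measure.
  rewrite pE -EFinM -EFinD lee_fin.
  have p0 : 0 <= fine (P [set w | O (fun j => Z j w)]) by exact: fine_ge0.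
  have := gauss_delta_ge0 eps D0.
  by have := ler_wpM2r p0 e1; rewrite mul1r; lra.
pose r := Num.sqrt q; have r0 : 0 < r by rewrite sqrtr_gt0.
have r2 : r ^+ 2 = q by rewrite sqr_sqrtr// ltW.
have sr0 : s * r != 0 by rewrite mulf_neq0 ?gt_eqF.
(* The value of [Y] at which [tilt] equals [expR eps]. *)
pose t := s ^+ 2 * eps + q / 2.
pose Y w := \sum_(j < m) u j * Z j w.
have nY : normal_rv P Y (s * r).
  apply: (@normal_rv_sum _ _ _ _ _ Z u s) => //; rewrite ?index_enum_uniq//.
  by rewrite gt_eqF.
have tailY y : P (Y @^-1` `]y, +oo[%classic) = normal_prob 0 1 `]y / (s * r),
  +oo[%classic.
  rewrite (nY _ (measurable_itv _)).
  have := @normal_prob_affine _ (s * r) 0 1 `]y,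
    +oo[%classic sr0 (oner_neq0 R) (measurable_itv _).
  rewrite mulr1 => <-; congr normal_prob.
  apply/seteqP; split => x /=; rewrite !in_itv/= !andbT addr0.
    by rewrite ltr_pdivrMr 1?mulrC// mulr_gt0.
  by rewrite ltr_pdivrMr 1?[x * _]mulrC// mulr_gt0.
pose H := [set z : 'I_m -> R | t < \sum_(j < m) u j * z j].
have mH : vec_measurable H.
  have mS : measurable_fun setT (fun z : g_sigma_algebraType (@rect_sets R m) =>
      \sum_(j < m) u j * z j).
    apply: measurable_sum => j; apply: measurable_funM => //.
    exact: measurable_vec_coord.
  have := mS measurableT _ (measurable_itv `]t, +oo[); rewrite setTI.
  by congr (vec_measurable _); apply/seteqP; split => z /=;
    rewrite in_itv/= andbT.
have P0H : P [set w | H (fun j =>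
  Z j w)] = normal_prob 0 1 `]t / (s * r), +oo[%classic.
  rewrite -tailY; congr (P _).
  by apply/seteqP; split => w; rewrite /= in_itv/= andbT.
have P1H : P [set w | H (fun j => Z j w + u j)] =
    normal_prob 0 1 `](t - q) / (s * r), +oo[%classic.
  rewrite -tailY; congr (P _).
  have e w : \sum_(j < m) u j * (Z j w + u j) = Y w + q.
    by rewrite -big_split/=; apply: eq_bigr => j _; rewrite mulrDr expr2.
  by apply/seteqP; split => w; rewrite /= in_itv/= andbT /H/= e ltrBlDr.
have tiltE w : tilt Z s u w = expR ((Y w - q / 2) / s ^+ 2).
  rewrite /tilt -expR_sum; congr expR; rewrite -mulr_suml sumrB;
    congr ((_ - _) / _).
  by rewrite -mulr_suml.
have mHZ : measurable [set w | H (fun j =>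
  Z j w)] by exact: vec_measurable_preimage.
have := @neyman_pearson _ _ _ P (cst 1) (tilt Z s u) (expR eps)
  [set w | O (fun j => Z j w)] [set w | H (fun j => Z j w)]
  (measurable_cst _) (measurable_tilt _ mZ u) (fun _ => ler01) (tilt_ge0 _ _ u)
  (expR_ge0 _) mOZ mHZ.
rewrite -!(cameron_martin s_gt0 mZ iZ nZ)//.
have ic (A : set T) : measurable A ->
    (\int[P]_(w in A) (@cst T R 1 w)%:E = P A)%E.
  by move=> mA; rewrite -[RHS]mul1e -(@integral_cst _ _ _ P _ mA 1%E).
rewrite !ic// P0H P1H.
have s20 : 0 < s ^+ 2 by rewrite exprn_gt0.
have NP1 w : H (fun j => Z j w) -> expR eps * cst 1 w <= tilt Z s u w.
  rewrite /H/= -/(Y w) mulr1 tiltE ler_expR ler_pdivlMr// /t => ?.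
  by rewrite lerBrDr mulrC ltW.
have NP2 w : ~ H (fun j => Z j w) -> tilt Z s u w <= expR eps * cst 1 w.
  move/negP; rewrite /H/= -/(Y w)
    -leNgt mulr1 tiltE ler_expR ler_pdivrMr// /t => ?.
  by rewrite lerBlDr mulrC.
move=> /(_ NP1 NP2).
set c := t / (s * r).
have -> : (t - q) / (s * r) = c - r / s.
  by rewrite /c -r2; field; rewrite !gt_eqF.
have rD : r / s <= D.
  have := ler_wsqrtr uD;
    rewrite sqrtr_sqr ger0_norm ?(ltW (mulr_gt0 D0 s_gt0))//.
  by rewrite ler_pdivrMr.
(* The shift [r / s] is enlarged to [D] only inside the probability of the half-line beyond [c]. As
   [le_gauss_delta] holds for every event, it applies to this half-line even when [c] is not the
   optimal threshold for [D]; monotonicity of [gauss_delta] in [D] does not have to be proved. *)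
have tail_le : (normal_prob 0 1 `](c - r / s)%R,
  +oo[%classic <= normal_prob D 1 `]c, +oo[%classic)%E.
  rewrite (normal_prob_shift_tail D) -[D - c]opprB -normal_prob_tail.
  apply: le_measure; rewrite ?inE//; apply: subset_itvr.
  by rewrite bnd_simp lerB.
have := @le_gauss_delta eps D `]c, +oo[%classic D0 (measurable_itv _).
move: tail_le; rewrite (normal_prob_shift_tail D) !normal_prob_tail.
have mOu : measurable [set w | O (fun j => Z j w + u j)].
  apply: (vec_measurable_preimage (X := fun j w => Z j w + u j)) => // j.
  exact: measurable_funD.
have -> : P [set w | O (fun j => Z j w + u j)] = (fine (P [set w | O (fun j =>
  Z j w + u j)]))%:E.
  by rewrite fineK// fin_num_measure.
have -> : P [set w | O (fun j => Z j w)] = (fine (P [set w | O (fun j =>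
  Z j w)]))%:E.
  by rewrite fineK// fin_num_measure.
rewrite -!EFinM -!EFinD !lee_fin; lra.
Qed.

(** Translating [O] by [v] reduces the comparison to the shift [u - v]. *)
Lemma gaussian_mechanism (eps D : R) (u v : 'I_m -> R) (O : set ('I_m -> R)) :
  0 <= eps -> 0 < D -> \sum_(j < m) (u j - v j) ^+ 2 <= (D * s) ^+ 2 ->
  vec_measurable O ->
  (P [set w | O (fun j => (Z j w + u j)%R)] <=
   (expR eps)%:E * P [set w | O (fun j => (Z j w + v j)%R)] +
   (gauss_delta eps D)%:E)%E.
Proof.
move=> eps0 D0 uD mO.
have := gaussian_shift eps0 D0 uD (vec_measurable_shift v mO).
congr (P _ <= _)%E; apply/seteqP; split => w /=.
  by rewrite (_ : (fun j => _) = (fun j => Z j w + u j))//; apply/funext => j;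
    rewrite -addrA subrK.
by rewrite [X in _ -> O X](_ : _ = (fun j => Z j w + u j))//;
  apply/funext => j; rewrite -addrA subrK.
Qed.

End gaussian_mechanism.

(** * The noise of the protocol *)

Section protocol_noise.
Context {R : realType} {d : measure_display} {T : measurableType d}.
Variables (P : probability T R) (N m : nat) (S : finType) (sigma p : R).
Variables (b : S -> T -> R) (v W : 'I_N -> 'I_m -> T -> R).
Hypothesis N_gt0 : (0 < N)%N.
Hypothesis sigma_gt0 : 0 < sigma.
Hypothesis mb : forall s, measurable_fun setT (b s).
Hypothesis mv : forall i j, measurable_fun setT (v i j).
Hypothesis mW : forall i j, measurable_fun setT (W i j).
Hypothesis bernoulli_b : forall s,
  P (b s @^-1` [set 1]) = p%:E /\ P (b s @^-1` [set 0]) = (1 - p)%:E.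
Hypothesis gamma_v : forall i j (A : set R), measurable A ->
  P (v i j @^-1` A) = gamma_prob (3 / 2) (1 / 2) A.
Hypothesis unif_W : forall i j (A : set R), measurable A ->
  P (W i j @^-1` A) = unif_prob (- (1 / 2)) (1 / 2) A.
Hypothesis indep : mutually_independent P (fl_family b v W).

Let mfam k : measurable_fun setT (fl_family b v W k).
Proof. by case: k => [[s|ij]|ij] /=. Qed.

(* The actual noise has the local gradients in place of [x]; they depend on the
   batch, and freezing them is what conditioning on the batch amounts to. *)
Definition frozen_noise (x : 'I_N -> 'I_m -> R) (j : 'I_m) (w : T) : R :=
  N%:R^-1 * \sum_(i < N) dither_error sigma (x i j) (v i j w) (W i j w).

Lemma measurable_frozen_noise x j : measurable_fun setT (frozen_noise x j).
Proof.
apply: measurable_funM => //; apply: measurable_sum => i.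
exact: measurable_dither_error.
Qed.

Lemma frozen_noise_normal x j :
  normal_rv P (frozen_noise x j) (sigma / Num.sqrt N%:R).
Proof.
pose F i w := dither_error sigma (x i j) (v i j w) (W i j w).
have mF i : measurable_fun setT (F i) by exact: measurable_dither_error.
(* At the fixed coordinate [j], block [i] consists of [v i j] and [W i j]; everything else is
   discarded. *)
pose f (k : (S + ('I_N * 'I_m)) + ('I_N * 'I_m)) : option 'I_N :=
  match k with
  | inl (inl _) => None
  | inl (inr ij) | inr ij => if ij.2 == j then Some ij.1 else None
  end.
have iF : mutually_independent P F.
  apply: (mutually_independent_group (f := f) mfam indep) => i.
  apply: measurable_dither_error => //.
    apply: (@measurable_fun_cylinders _ _ _ _ (fl_family b v W)
      _ (inl (inr (i, j)))).
    by rewrite /= eqxx.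
  apply: (@measurable_fun_cylinders _ _ _ _ (fl_family b v W) _ (inr (i, j))).
  by rewrite /= eqxx.
have nF i : normal_rv P (F i) sigma.
  apply: dither_error_normal => //; last 2 first.
  - exact: gamma_v.
  - exact: unif_W.
  move=> A A' mA mA'.
  exact: (@mutually_independent2 _ _ _ _ _ _ (inl (inr (i, j))) (inr (i,
    j)) _ _ _ indep).
have N0 : N%:R != 0 :> R by rewrite pnatr_eq0 -lt0n.
have sumE : \sum_(i <- index_enum 'I_N) (N%:R^-1 : R) ^+ 2 = N%:R^-1.
  rewrite sumr_const card_ord -(mulr_natr (N%:R^-1 ^+ 2) N).
  by rewrite expr2 -mulrA mulVf// mulr1.
have := @normal_rv_sum _ _ _ P _ F (fun=> N%:R^-1) sigma (index_enum 'I_N)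
  _ (index_enum_uniq _) mF iF nF.
rewrite sumE sqrtrV ?ler0n// gt_eqF// invr_gt0 ltr0n => /(_ isT N_gt0) H A mA.
by rewrite -H//; congr (P _); apply/seteqP; split => w /=; rewrite -mulr_sumr.
Qed.

(** Batch indicators and noise coordinates in one family, so that a single application of block
    independence separates the coordinates from each other and from the batch. *)
Definition batch_noise (x : 'I_N -> 'I_m -> R) (k : S + 'I_m) : T -> R :=
  match k with inl s => b s | inr j => frozen_noise x j end.

Lemma batch_noise_independent x : mutually_independent P (batch_noise x).
Proof.
pose f (k : (S + ('I_N * 'I_m)) + ('I_N * 'I_m)) : option (S + 'I_m) :=
  match k with
  | inl (inl s) => Some (inl s)
  | inl (inr ij) | inr ij => Some (inr ij.2)
  end.
apply: (mutually_independent_group (f := f) mfam indep) => -[s|j].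
  exact: (@measurable_fun_cylinders _ _ _ _ (fl_family b v W) _ (inl (inl s))).
apply: measurable_funM => //; apply: measurable_sum => i.
apply: measurable_dither_error => //.
  exact: (@measurable_fun_cylinders _ _ _ _ (fl_family b v W) _ (inl (inr (i,
    j)))).
exact: (@measurable_fun_cylinders _ _ _ _ (fl_family b v W) _ (inr (i, j))).
Qed.

Lemma batch_noise_rect x (A : 'I_m -> set R) (E : S -> set R) :
  (forall j, measurable (A j)) -> (forall s, measurable (E s)) ->
  P (\bigcap_j (frozen_noise x j @^-1` A j) `&` \bigcap_s (b s @^-1` E s)) =
  (\prod_(j < m) normal_prob 0 (sigma / Num.sqrt N%:R) (A j) *
   \prod_s P (b s @^-1` E s))%E.
Proof.
move=> mA mE.
pose G k := match k with inl s => E s | inr j => A j end.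
transitivity (P (\bigcap_k (batch_noise x k @^-1` G k))).
  congr (P _); apply/seteqP; split => [w [Aw Ew] [s|j] _|w Gw].
  - exact: Ew.
  - exact: Aw.
  - by split => [j _|s _]; [exact: (Gw (inr j))|exact: (Gw (inl s))].
rewrite batch_noise_independent; last by case.
rewrite big_sumType/= muleC; congr (_ * _)%E.
by apply: eq_bigr => j _; exact: frozen_noise_normal.
Qed.

Lemma batch_rect (E : S -> set R) : (forall s, measurable (E s)) ->
  P (\bigcap_s (b s @^-1` E s)) = (\prod_s P (b s @^-1` E s))%E.
Proof.
pose f (k : (S + ('I_N * 'I_m)) + ('I_N * 'I_m)) : option S :=
  if k is inl (inl s) then Some s else None.
apply: (mutually_independent_group (f := f) mfam indep) => s.
exact: (@measurable_fun_cylinders _ _ _ _ (fl_family b v W) _ (inl (inl s))).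
Qed.

Lemma frozen_noise_rect x (A : 'I_m -> set R) : (forall j, measurable (A j)) ->
  P (\bigcap_j (frozen_noise x j @^-1` A j)) =
  (\prod_(j < m) normal_prob 0 (sigma / Num.sqrt N%:R) (A j))%E.
Proof.
move=> mA; have := @batch_noise_rect x A (fun=> setT) mA (fun=> measurableT).
rewrite [X in _ = (_ * X)%E -> _]big1 ?mule1 => [<-|s _]; last first.
  by rewrite preimage_setT probability_setT.
by congr (P _); apply/esym/setIidl => w _ s _.
Qed.

Lemma frozen_noise_independent x : mutually_independent P (frozen_noise x).
Proof.
move=> A mA; rewrite frozen_noise_rect//.
by apply: eq_bigr => j _; rewrite frozen_noise_normal.
Qed.

Definition batch_event (e : {ffun S -> bool}) : set T :=
  \bigcap_s (b s @^-1` [set (e s)%:R]).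

Definition batch_weight (e : {ffun S -> bool}) : R :=
  \prod_s (if e s then p else 1 - p).

Lemma measurable_batch_event e : measurable (batch_event e).
Proof.
apply: fin_bigcap_measurableT => s.
by rewrite -[X in measurable X]setTI; exact: mb.
Qed.

Lemma batch_eventE e : P (batch_event e) = (batch_weight e)%:E.
Proof.
rewrite batch_rect// /batch_weight -prodEFin; apply: eq_bigr => s _.
by have [P1 P0] := bernoulli_b s; case: (e s).
Qed.

Lemma sum_batch_weight : \sum_e batch_weight e = 1.
Proof.
rewrite /batch_weight -(bigA_distr_bigA (fun _ c => if c then p else 1 - p))/=.
by rewrite big1// => s _; rewrite big_bool/= addrC subrK.
Qed.

(** The real variables [b s] take the values 0 and 1 only almost surely. The batch events are
    disjoint and their probabilities sum to one, so what they leave uncovered is a null set. *)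
Lemma total_probability (F : set T) : measurable F ->
  P F = (\sum_(e : {ffun S -> bool}) P (F `&` batch_event e))%E.
Proof.
move=> mF.
have mFe e : measurable (F `&` batch_event e).
  by apply: measurableI => //; exact: measurable_batch_event.
have be_inj w e e' : batch_event e w -> batch_event e' w -> e = e'.
  move=> ew ew'; apply/ffunP => s; have := ew s Logic.I;
    rewrite /= (ew' s Logic.I).
  by case: (e s); case: (e' s) => // /eqP; rewrite ?oner_eq0// eq_sym oner_eq0.
have sumU (G : set T) : measurable G ->
    (\sum_(e : {ffun S -> bool}) P (G `&` batch_event e) =
     P (G `&` \bigcup_e batch_event e))%E.
  move=> mG; rewrite setI_bigcupr.
  rewrite measure_fin_bigcup//.
  - have -> : [set: {ffun S -> bool}] = [set` index_enum {ffun S -> bool}].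
      by apply/seteqP; split => // e _ /=; rewrite mem_index_enum.
    by rewrite -fsbig_seq// index_enum_uniq.
  - exact: finite_finset.
  - move=> e e' _ _ [w [[_ ew] [_ ew']]]; exact: be_inj ew ew'.
  - by move=> e _; apply: measurableI => //; exact: measurable_batch_event.
have mU : measurable (\bigcup_e batch_event e).
  by apply: fin_bigcup_measurable => [|e _];
    [exact: finite_finset|exact: measurable_batch_event].
have PU : P (\bigcup_e batch_event e) = 1%E.
  rewrite -[X in P X]setTI -sumU//.
  under eq_bigr do rewrite setTI batch_eventE.
  by rewrite sumEFin sum_batch_weight.
rewrite sumU// (measureDI P mF mU) [X in (X + _)%E](_ : _ = 0%E) ?add0e//.
apply/eqP; rewrite eq_le measure_ge0 andbT.
apply: (@le_trans _ _ (P (~` \bigcup_e batch_event e))).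
  apply: le_measure; rewrite ?inE; first exact: measurableD.
  - exact: measurableC.
  - by move=> w [].
by rewrite probability_setC// PU subee.
Qed.

Lemma batch_weight_ge0 e : 0 <= batch_weight e.
Proof. by rewrite -lee_fin -batch_eventE. Qed.

Lemma frozen_noise_batch x x0 e (O : set ('I_m -> R)) : vec_measurable O ->
  P ([set w | O (fun j => frozen_noise x j w)] `&` batch_event e) =
  ((batch_weight e)%:E * P [set w | O (fun j => frozen_noise x0 j w)])%E.
Proof.
move=> mO; have mB := measurable_batch_event e.
have mY y := measurable_fun_vec (measurable_frozen_noise y).
have [m1 m1E] := pushforward_measure_exists (mrestr P mB) (mY x).
have [m2 m2E] := pushforward_measure_exists
  (mscale (NngNum (batch_weight_ge0 e)) P) (mY x0).
transitivity (m1 O); first by rewrite m1E.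
transitivity (m2 O); last by rewrite m2E.
apply: vec_measure_unique mO => [|A mA].
  rewrite m1E; apply: le_lt_trans (ltry 1); apply: probability_le1.
  by rewrite preimage_setT; exact: measurableI.
rewrite m1E m2E !preimage_bigcap /mrestr /mscale/=.
transitivity (P (\bigcap_j (frozen_noise x j @^-1` A j) `&` batch_event e)).
  by [].
rewrite batch_noise_rect// -batch_rect// batch_eventE muleC; congr (_ * _)%E.
by rewrite -(frozen_noise_rect x0 mA).
Qed.

End protocol_noise.

(** * Clipping and subsampling *)

Lemma clip_norm {R : realType} (C : R) (m : nat) (x : 'I_m -> R) : 0 < C ->
  \sum_(j < m) clip C x j ^+ 2 <= C ^+ 2.
Proof.
move=> C0; rewrite /clip; set M := Num.max 1 _.
have q0 : 0 <= \sum_(j < m) x j ^+ 2 by apply: sumr_ge0 => j _; exact: sqr_ge0.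
have M0 : 0 < M by rewrite /M lt_max ltr01.
under eq_bigr do rewrite exprMn exprVn.
rewrite -mulr_suml ler_pdivrMr ?exprn_gt0// -exprMn.
rewrite -[leLHS](sqr_sqrtr q0) -/(l2norm x) ler_sqr ?nnegrE ?sqrtr_ge0//.
  by rewrite -ler_pdivrMl// mulrC /M le_max lexx orbT.
by rewrite mulr_ge0 ?ltW.
Qed.

(** From [(a - b)^2 <= 2 a^2 + 2 b^2] in each coordinate, and [2 C^2 + 2 C^2 = (2 C)^2]. *)
Lemma clip_diff_norm {R : realType} (C : R) (m : nat) (x y : 'I_m -> R)
  : 0 < C ->
  \sum_(j < m) (clip C x j - clip C y j) ^+ 2 <= (2 * C) ^+ 2.
Proof.
move=> C0; have hx := clip_norm x C0; have hy := clip_norm y C0.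
apply: (@le_trans _ _ (\sum_(j < m)
  (2 * clip C x j ^+ 2 + 2 * clip C y j ^+ 2))).
  by apply: ler_sum => j _; have := sqr_ge0 (clip C x j + clip C y j); lra.
by rewrite big_split/= -!mulr_sumr; lra.
Qed.

(** Here [a0] is the probability without the differing sample, common to both data sets, and [a1],
    [a1'] are those with it. After cancelling [p], the claim bounds [a1 - delta] by a combination of
    [a0] and [a1'] whose nonnegative coefficients sum to [E], hence it is an average of the two
    assumed bounds. *)
Lemma subsampling_amplification {R : realFieldType} (p E delta a0 a1 a1' : R) :
  0 <= p <= 1 -> 1 <= E -> a1 <= E * a0 + delta -> a1 <= E * a1' + delta ->
  (1 - p) * a0 + p * a1 <=
  (1 + p * (E - 1)) * ((1 - p) * a0 + p * a1') + p * delta.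
Proof.
move=> /andP[p0 p1] E1 h0 h1.
have E0 : 0 < E by apply: lt_le_trans E1.
suff : a1 - delta <= (E - 1) * (1 - p) * a0 + (1 - p + p * E) * a1'.
  by move=> h; have := ler_wpM2l p0 h; lra.
rewrite -(ler_pM2l E0).
have k1 : 0 <= (E - 1) * (1 - p) by rewrite mulr_ge0 ?subr_ge0.
have k2 : 0 <= 1 - p + p * E by rewrite addr_ge0 ?subr_ge0// mulr_ge0// ltW.
have h0' : a1 - delta <= E * a0 by rewrite lerBlDr.
have h1' : a1 - delta <= E * a1' by rewrite lerBlDr.
by have := ler_wpM2l k1 h0'; have := ler_wpM2l k2 h1'; lra.
Qed.

Section bernoulli_flip.
Context {R : realType} {S : finType} (p : R) (s0 : S).

Definition set_slot (c : bool) (e : {ffun S -> bool}) : {ffun S -> bool} :=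
  [ffun s => if s == s0 then c else e s].

Let rest_weight (e : {ffun S -> bool}) : R :=
  \prod_(s | s != s0) (if e s then p else 1 - p).

Let batch_weight_split e :
  batch_weight p e = (if e s0 then p else 1 - p) * rest_weight e.
Proof. by rewrite /batch_weight (bigD1 s0). Qed.

Let rest_weight_set c e : rest_weight (set_slot c e) = rest_weight e.
Proof. by apply: eq_bigr => s /negbTE s_s0; rewrite ffunE s_s0. Qed.

Lemma sum_batch_split (h : {ffun S -> bool} -> R) :
  \sum_e batch_weight p e * h e =
  \sum_(e : {ffun S -> bool} | ~~ e s0)
    rest_weight e * ((1 - p) * h e + p * h (set_slot true e)).
Proof.
rewrite (bigID (fun e : {ffun S -> bool} => e s0))/= addrC.
under [RHS]eq_bigr do rewrite mulrDr; rewrite big_split/=; congr (_ + _).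
  by apply: eq_bigr => e /negbTE e0; rewrite batch_weight_split e0 mulrCA mulrA.
rewrite (reindex_onto (set_slot true) (set_slot false))/=; last first.
  by move=> e e0; apply/ffunP => s; rewrite !ffunE; case: eqP => // ->.
apply: eq_big => [e|e _].
  rewrite ffunE eqxx/=; apply/eqP/idP => [<-|e0]; first by rewrite ffunE eqxx.
  by apply/ffunP => s; rewrite !ffunE; case: eqP => // ->; rewrite (negbTE e0).
by rewrite batch_weight_split rest_weight_set ffunE eqxx mulrCA mulrA.
Qed.

(** The amplification inequality holds for each fixed batch outside [s0]; it is averaged with
    [rest_weight], whose total mass one keeps the additive term equal to [p * delta]. *)
Lemma batch_sum_le (h h' : {ffun S -> bool} -> R) (E delta : R) :
  0 <= p <= 1 -> 1 <= E ->
  (forall e : {ffun S -> bool}, ~~ e s0 -> h e = h' e) ->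
  (forall e : {ffun S -> bool}, ~~ e s0 ->
     h (set_slot true e) <= E * h e + delta) ->
  (forall e : {ffun S -> bool}, ~~ e s0 ->
     h (set_slot true e) <= E * h' (set_slot true e) + delta) ->
  \sum_e batch_weight p e * h e <=
  (1 + p * (E - 1)) * (\sum_e batch_weight p e * h' e) + p * delta.
Proof.
move=> p01 E1 hh' h0 h1.
have rest1 : \sum_(e : {ffun S -> bool} | ~~ e s0) rest_weight e = 1.
  rewrite -(sum_batch_weight S p) -[RHS](eq_bigr _ (fun e _ =>
    mulr1 (batch_weight p e))).
  rewrite (sum_batch_split (fun=> 1)); apply: eq_bigr => e _.
  by rewrite !mulr1 subrK mulr1.
have -> : p * delta = p * delta * \sum_(e : {ffun S -> bool} | ~~ e s0)
  rest_weight e.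
  by rewrite rest1 mulr1.
rewrite !sum_batch_split !mulr_sumr -big_split/=.
apply: ler_sum => e e0;
  rewrite [X in _ <= X + _]mulrCA [p * delta * _]mulrC -mulrDr.
apply: ler_wpM2l.
  apply: prodr_ge0 => s _; case/andP : p01 => ? ?.
  by case: (e s); rewrite ?subr_ge0.
rewrite -(hh' e e0); apply: (@subsampling_amplification R) => //.
- exact: h0.
- exact: h1.
Qed.

End bernoulli_flip.

(** * The output as a mixture of Gaussian translates over batches, and its privacy *)

Theorem theorem1
  (R : realType) (d : measure_display) (T : measurableType d)
  (P : probability T R)
  (N m : nat) (S : finType) (own : S -> 'I_N) (Dat : Type)
  (grad : Dat -> 'I_m -> R) (C sigma p B : R)
  (b : S -> T -> R) (v W : 'I_N -> 'I_m -> T -> R) :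
  (0 < N)%N -> 0 < C -> 0 < sigma -> 0 < p <= 1 -> 0 < B ->
  (forall i : 'I_N, B = p * (#|[pred s | own s == i]|)%:R) ->
  (* measurability of the random variables *)
  (forall s, measurable_fun setT (b s)) ->
  (forall i j, measurable_fun setT (v i j)) ->
  (forall i j, measurable_fun setT (W i j)) ->
  (* Poisson sampling: b s is the Bernoulli(p) indicator that slot s is in the batch *)
  (forall s, P (b s @^-1` [set 1]) = p%:E /\ P (b s @^-1` [set 0]) = (1 - p)%:E) ->
  (* v_{i,j} ~ Gamma(shape 3/2, rate 1/2) *)
  (forall i j (A : set R), measurable A ->
     P (v i j @^-1` A) = gamma_prob (3 / 2) (1 / 2) A) ->
  (* W_{i,j} ~ Unif(-1/2, 1/2), so that U_{i,j} = Delta_{i,j} W_{i,j} ~ Unif(-Delta/2, Delta/2) *)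
  (forall i j (A : set R), measurable A ->
     P (W i j @^-1` A) = unif_prob (- (1 / 2)) (1 / 2) A) ->
  (* all sampling randomness is mutually independent *)
  mutually_independent P (fl_family b v W) ->
  let g := fl_output own grad C sigma B b v W in
  let gbar := avg_local_grad own grad C B b in
  (* (1) g = avg of local gradients + N(0, sigma^2/N I_m), the noise being
         independent of the batch selection *)
  (forall (D : S -> Dat) (A : 'I_m -> set R) (E : S -> set R),
     (forall j, measurable (A j)) -> (forall s, measurable (E s)) ->
     P ((\bigcap_j ((fun w => g D w j - gbar D w j) @^-1` A j)) `&`
        (\bigcap_s (b s @^-1` E s))) =
     ((\prod_(j < m) normal_prob 0 (sigma / Num.sqrt N%:R) (A j)) *
      P (\bigcap_s (b s @^-1` E s)))%E)
  /\
  (* (2) sample-level (eps, delta)-DP against the clients *)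
  (forall eps' : R, 0 < eps' ->
     let eps := ln (1 + p * (expR eps' - 1)) in
     let k := sigma * B * Num.sqrt N%:R in
     let delta := p * Phi (C / k - eps' * k / (2 * C))
                  - p * expR eps' * Phi (- (C / k) - eps' * k / (2 * C)) in
     sample_dp P g eps delta).
Proof.
move=> N0 C0 sigma0 p01 B0 _ mb mv mW bern gam unif indep g gbar.
have p_ge0 : 0 <= p by case/andP : p01 => /ltW.
pose lg := local_grad own grad C B b.
pose fg D (e : {ffun S -> bool}) (i : 'I_N) (j : 'I_m) : R :=
  B^-1 * \sum_(s | own s == i) (e s)%:R * clip C (grad (D s)) j.
have mlg D i j : measurable_fun setT (lg D i j).
  apply: measurable_funM => //.
  rewrite [X in measurable_fun _ X](_ : _ = fun w =>
      \sum_(s <- [seq s <- index_enum S | own s == i])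
        b s w * clip C (grad (D s)) j).
    by apply: measurable_sum => s; exact: measurable_funM.
  by apply/funext => w; rewrite big_filter.
have lgE D e i j w : batch_event b e w -> lg D i j w = fg D e i j.
  move=> ew; congr (_ * _); apply: eq_bigr => s _; congr (_ * _).
  exact: (ew s Logic.I).
have noiseE D w j : g D w j - gbar D w j =
    N%:R^-1 * \sum_(i < N) dither_error sigma (lg D i j w) (v i j w) (W i j w).
  by rewrite -mulrBr -sumrB.
have mnoise D j : measurable_fun setT (fun w => g D w j - gbar D w j).
  rewrite [X in measurable_fun _ X](_ : _ = fun w => N%:R^-1 *
      \sum_(i < N) dither_error sigma (lg D i j w) (v i j w) (W i j w)).
    apply: measurable_funM => //; apply: measurable_sum => i.
    exact: measurable_dither_error.
  by apply/funext => w; exact: noiseE.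
have frozenE D e j w : batch_event b e w ->
    g D w j - gbar D w j = frozen_noise sigma v W (fg D e) j w.
  move=> ew; rewrite noiseE; congr (_ * _); apply: eq_bigr => i _.
  by rewrite (lgE _ _ _ _ _ ew).
split.
  move=> D A E mA mE.
  have mbE (E' : S -> set R) : (forall s, measurable (E' s)) ->
      measurable (\bigcap_s (b s @^-1` E' s)).
    move=> mE'; apply: fin_bigcap_measurableT => s.
    by rewrite -[X in measurable X]setTI; exact: mb.
  have mF : measurable ((\bigcap_j ((fun w =>
    g D w j - gbar D w j) @^-1` A j)) `&`
        (\bigcap_s (b s @^-1` E s))).
    apply: measurableI; last exact: mbE.
    apply: fin_bigcap_measurableT => j.
    by rewrite -[X in measurable X]setTI; exact: mnoise.
  rewrite (total_probability mb mv mW bern indep mF).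
  rewrite [in RHS](total_probability mb mv mW bern indep (mbE E mE)).
  rewrite ge0_sume_distrr//; apply: eq_bigr => e _.
  (* Intersecting with singletons absorbs the batch event into a rectangle, on which the noise
     equals the one frozen at [fg D e]. *)
  pose E' s := E s `&` [set (e s)%:R].
  have mE' s : measurable (E' s) by exact: measurableI.
  have -> : \bigcap_s (b s @^-1` E s)
    `&` batch_event b e = \bigcap_s (b s @^-1` E' s).
    apply/seteqP; split => [w [Ew ew] s _|w Ew]; first by split;
      [exact: Ew|exact: ew].
    by split => s _; have [] := Ew s Logic.I.
  rewrite (batch_rect mb mv mW indep mE').
  rewrite -(batch_noise_rect N0 sigma0 mb mv mW gam unif indep (fg D e) mA mE').
  congr (P _); apply/seteqP; split => w.
    move=> [[Aw Ew] ew]; split => [j _|s _].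
      by rewrite /= -(frozenE D e)//; exact: Aw.
    by split; [exact: Ew|exact: ew].
  move=> [Aw Ew].
  have ew : batch_event b e w by move=> s _; have [] := Ew s Logic.I.
  split=> //; split => [j _|s _]; last by have [] := Ew s Logic.I.
  by rewrite /= (frozenE D e)//; exact: Aw.
move=> eps' eps'0 eps k delta D D' [s0 DD'] O mO.
pose Z := frozen_noise sigma v W (fun _ _ => 0).
pose center D e j : R := N%:R^-1 * \sum_(i < N) fg D e i j.
pose Q (c : 'I_m -> R) := fine (P [set w | O (fun j => Z j w + c j)]).
have mZ j : measurable_fun setT (Z j) by exact: measurable_frozen_noise.
have QE c : P [set w | O (fun j => Z j w + c j)] = (Q c)%:E.
  rewrite /Q fineK// fin_num_measure//.
  apply: (vec_measurable_preimage (X := fun j w => Z j w + c j)) => // j.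
  exact: measurable_funD.
(* Only the centers depend on the data set; the weights and [Q] are shared by [D] and [D']. *)
have outE D0 : P (g D0 @^-1` O) =
    (\sum_(e : {ffun S -> bool}) batch_weight p e * Q (center D0 e))%:E.
  have mg : measurable (g D0 @^-1` O).
    apply: (vec_measurable_preimage (X := fun j w => g D0 w j)) => // j.
    rewrite [X in measurable_fun _ X](_ : _ =
        fun w => (g D0 w j - gbar D0 w j) + gbar D0 w j).
      apply: measurable_funD => //; apply: measurable_funM => //.
      by apply: measurable_sum => i; exact: mlg.
    by apply/funext => w; rewrite subrK.
  rewrite (total_probability mb mv mW bern indep mg) -sumEFin.
  apply: eq_bigr => e _; rewrite EFinM -QE.
  rewrite -(frozen_noise_batch N0 sigma0 mb mv mW bern gam unif indep (fg D0 e)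
    (fun _ _ => 0) e (vec_measurable_shift (center D0 e) mO)).
  have gE w : batch_event b e w -> g D0 w =
      (fun j => frozen_noise sigma v W (fg D0 e) j w + center D0 e j).
    move=> ew; apply/funext => j;
      rewrite -(frozenE D0 e)// -[LHS](subrK (gbar D0 w j)).
    congr (_ + _); congr (_ * _); apply: eq_bigr => i _; exact: lgE.
  congr (P _); apply/seteqP; split => w [Ow ew]; split => //=.
    by rewrite -gE.
  by rewrite /= gE.
(* Each slot has one owner and [B] is common to all clients, so the double sum is a single sum over
   slots: one sample moves the center by its clipped gradient divided by [N B]. *)
have centerE D0 e j : center D0 e j =
    (N%:R * B)^-1 * \sum_s (e s)%:R * clip C (grad (D0 s)) j.
  rewrite /center /fg -mulr_sumr mulrA -invfM; congr (_ * _).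
  by rewrite (partition_big own predT).
have k0 : 0 < k by rewrite !mulr_gt0 ?sqrtr_gt0 ?ltr0n.
(* The largest shift [2 C / (N B)] in units of the noise deviation [sigma / sqrt N]. *)
pose Dl := 2 * C / k.
have Dl0 : 0 < Dl by apply: divr_gt0 => //; exact: mulr_gt0.
have NB0 : 0 < N%:R * B by rewrite mulr_gt0 ?ltr0n.
have DlE : Dl * (sigma / Num.sqrt N%:R) = (N%:R * B)^-1 * (2 * C).
  have sN : Num.sqrt N%:R ^+ 2 = N%:R :> R by rewrite sqr_sqrtr ?ler0n.
  have sN0 : Num.sqrt N%:R != 0 :> R by rewrite gt_eqF// sqrtr_gt0 ltr0n.
  rewrite /Dl /k -[in RHS]sN; field.
  by rewrite sN0 !gt_eqF.
have QDP c c' : \sum_(j < m) (c j - c' j) ^+ 2 <= ((N%:R * B)^-1 * (2 * C))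
  ^+ 2 ->
    Q c <= expR eps' * Q c' + gauss_delta eps' Dl.
  rewrite -DlE => cc'.
  have := gaussian_mechanism _ mZ
    (frozen_noise_independent N0 sigma0 mb mv mW gam unif indep (fun _ _ => 0))
    (frozen_noise_normal N0 sigma0 mb mv mW gam unif indep (fun _ _ => 0))
    (ltW eps'0) Dl0 cc' mO.
  rewrite !QE -EFinM -EFinD lee_fin; apply.
  by rewrite divr_gt0 ?sqrtr_gt0 ?ltr0n.
have deltaE : delta = p * gauss_delta eps' Dl.
  have kC : eps' / Dl = eps' * k / (2 * C).
    by rewrite /Dl; field; rewrite !gt_eqF.
  have kC2 : Dl / 2 = C / k by rewrite /Dl; field; rewrite gt_eqF.
  by rewrite /delta /gauss_delta kC kC2; ring.
have e1 : 1 <= expR eps' by rewrite -expR0 ler_expR ltW.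
have epsE : expR eps = 1 + p * (expR eps' - 1).
  by rewrite lnK// posrE ltr_wpDr// mulr_ge0// subr_ge0.
rewrite !outE -EFinM -EFinD lee_fin epsE deltaE.
apply: (batch_sum_le (s0 := s0)) => //.
- by rewrite p_ge0/=; case/andP : p01.
- move=> e e0; congr Q; apply/funext => j; rewrite !centerE; congr (_ * _).
  apply: eq_bigr => s _; have [->|ss0] := eqVneq s s0.
    by rewrite (negbTE e0) !mul0r.
  by rewrite DD'.
(* The shift here is at most [C / (N B)]. It is bounded by the larger [2 C / (N B)], because
   [batch_sum_le] takes the same additive term in both comparisons. *)
- move=> e e0; apply: QDP.
  have dE j : center D (set_slot s0 true e) j - center D e j =
      (N%:R * B)^-1 * clip C (grad (D s0)) j.
    rewrite !centerE -mulrBr; congr (_ * _); rewrite -sumrB (bigD1 s0)//= big1.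
      by rewrite ffunE eqxx (negbTE e0) mul0r subr0 mul1r addr0.
    by move=> s /negbTE ss0; rewrite ffunE ss0 subrr.
  under eq_bigr do rewrite dE exprMn.
  rewrite -mulr_sumr exprMn ler_wpM2l ?sqr_ge0// (le_trans (clip_norm _ C0))//.
  by rewrite ler_sqr ?nnegrE ?mulr_ge0 ?(ltW C0)//; lra.
- move=> e e0; apply: QDP.
  have dE j : center D (set_slot s0 true e) j - center D' (set_slot s0 true e)
    j =
      (N%:R * B)^-1 * (clip C (grad (D s0)) j - clip C (grad (D' s0)) j).
    rewrite !centerE -mulrBr; congr (_ * _); rewrite -sumrB (bigD1 s0)//= big1.
      by rewrite ffunE eqxx !mul1r addr0.
    by move=> s ss0; rewrite DD'// subrr.
  under eq_bigr do rewrite dE exprMn.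
  rewrite -mulr_sumr exprMn ler_wpM2l ?sqr_ge0//.
  exact: clip_diff_norm.
Qed.
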